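(* For every $\beta > 0$ and $\delta >0$, there exists $C>0$ such that the following holds. Let $A \subset \mathbb{Z}^n$ be a two-cube with differences $d_1,\ldots,d_n$. Let $B \subseteq \{\pm 1\}^n$ be of size $2^{\beta n}$ and let $Y$ be uniformly distributed in $B$. (1) For all but $2^{n(1-\beta +\delta)}$ directions $x \in A$, $$\max_{k \in \mathbb{Z}} \Pr_Y\left[\langle x,Y\rangle =k\right] \leq C \sqrt{\frac{\ln(n)}{n}} .$$ (2) If $d_1,\ldots,d_n$ are distinct, then for all but $2^{n(1-\beta +\delta)}$ directions $x \in A$, $$\max_{k \in \mathbb{Z}} \Pr_Y\left[\langle x,Y\rangle =k\right] \leq C \sqrt{\frac{\ln(n)}{n^3}} .$$ (3) If $\{d_1,\ldots, d_n\}$ is a weak Sidon set of size $n$, then for all but $2^{n(1-\beta +\delta)}$ directions $x \in A$, $$\max_{k \in \mathbb{Z}} \Pr_Y\left[\langle x,Y\rangle =k\right] \leq C \sqrt{\frac{\ln(n)}{n^5}} .$$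
   Context: Here $n$ is the dimension and $\langle x,y\rangle=\sum_{j=1}^n x_jy_j$. A set $A \subset \mathbb{Z}^n$ is a two-cube if $A = A_1 \times A_2 \times \cdots \times A_n$, where each $A_j = \{u_j,v_j\}$ consists of two distinct integers. The differences of $A$ are the numbers $d_j = u_j - v_j$ for $j \in [n]=\{1,\dots,n\}$. A set $S \subset \mathbb{Z}$ of size $n$ is a weak Sidon set if the number of solutions to the equation $\epsilon_1 s_1+ \epsilon_2 s_2 = \epsilon_3 s_3+\epsilon_4 s_4$ with $\epsilon_1,\ldots,\epsilon_4 \in \{\pm 1\}$ and $s_1,\ldots,s_4 \in S$ is at most $100 n^2$. ''All but $N$ directions'' means that the number of exceptional directions is at most $N$.
   Formalization: The dimension is assumed to be n ≥ 2: for n = 1 we have ln(n) = 0, so the bounds are 0 and the claim fails (e.g. β = 1, B = {1,−1}, δ < 1). *)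

(* Defs.v *)
(* MathComp / MathComp-Analysis *)
From HB Require Import structures.
From mathcomp Require Import all_boot all_order all_algebra.
From mathcomp Require Import finmap.
From mathcomp Require Import boolp classical_sets functions cardinality reals exp.

Set Implicit Arguments.
Unset Strict Implicit.
Unset Printing Implicit Defensive.

Import Order.TTheory GRing.Theory Num.Theory.

Local Open Scope classical_set_scope.
Local Open Scope ring_scope.

Definition dotz (n : nat) (x y : 'rV[int]_n) : int := \sum_j x 0 j * y 0 j.

(* The endpoints u_j, v_j are kept as data: a two-cube determines its
   differences only up to sign, so distinctness of the differences and the
   set they form depend on the labelling. *)
Definition two_cube (n : nat) (A : set 'rV[int]_n) (u v : 'rV[int]_n) : Prop :=
  (forall j, u 0 j <> v 0 j) /\
  A = [set x | forall j, x 0 j = u 0 j \/ x 0 j = v 0 j].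

Definition cube_diff (n : nat) (u v : 'rV[int]_n) (j : 'I_n) : int :=
  u 0 j - v 0 j.

Definition sign_vectors (n : nat) (B : {fset 'rV[int]_n}) : Prop :=
  forall y, y \in B -> forall j, y 0 j = 1 \/ y 0 j = -1.

Definition signs : {fset int} := [fset 1; -1]%fset.

(* Solutions are counted as tuples ((e1, s1), (e2, s2)), ((e3, s3), (e4, s4)). *)
Definition sidon_solutions (S : {fset int}) :
    {fset ((int * int) * (int * int)) * ((int * int) * (int * int))} :=
  let P := (signs `*` S)%fset in
  [fset t in ((P `*` P) `*` (P `*` P))%fset |
    let: (((e1, s1), (e2, s2)), ((e3, s3), (e4, s4))) := t in
    (e1 * s1 + e2 * s2 == e3 * s3 + e4 * s4)%R]%fset.

Definition weak_sidon (n : nat) (S : {fset int}) : Prop :=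
  #|` S| = n /\ (#|` sidon_solutions S| <= 100 * n ^ 2)%N.

Definition prob_dot (R : realType) (n : nat) (B : {fset 'rV[int]_n})
    (x : 'rV[int]_n) (k : int) : R :=
  #|` [fset y in B | dotz x y == k]%fset|%:R / #|` B|%:R.

(* The supremum is attained, see [max_prob_attained]. *)
Definition max_prob (R : realType) (n : nat) (B : {fset 'rV[int]_n})
    (x : 'rV[int]_n) : R :=
  sup [set prob_dot R B x k | k in [set: int]].

(* [fset_set] is a junk value on infinite sets, hence the finiteness clause. *)
Definition all_but (R : realType) (T : choiceType) (N : R) (A : set T)
    (P : T -> Prop) : Prop :=
  finite_set (A `&` [set x | ~ P x]) /\
  #|` fset_set (A `&` [set x | ~ P x])|%:R <= N.

Lemma max_prob_attained (R : realType) (n : nat) (B : {fset 'rV[int]_n})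
    (x : 'rV[int]_n) :
  (exists k, max_prob R B x = prob_dot R B x k) /\
  (forall k, prob_dot R B x k <= max_prob R B x).
Proof.
pose c k := #|` [fset y in B | dotz x y == k]%fset|.
have cB k : (c k <= #|` B|)%N.
  by apply: fsubset_leq_card; apply/fsubsetP => y; rewrite !inE => /andP[].
pose p m := `[< exists k, c k = m >].
have exp : exists m, p m by exists (c 0); apply/asboolP; exists 0.
have ubp m : p m -> (m <= #|` B|)%N by move=> /asboolP[k <-].
case: (ex_maxnP exp ubp) => m /asboolP[k0 ck0] mmax.
have le_k0 k : prob_dot R B x k <= prob_dot R B x k0.
  rewrite /prob_dot ler_wpM2r ?invr_ge0 ?ler0n // ler_nat -!/(c _) ck0.
  by apply: mmax; apply/asboolP; exists k.
have hub : ubound [set prob_dot R B x k | k in [set: int]] (prob_dot R B x k0).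
  by move=> _ [k _ <-].
have le_sup k : prob_dot R B x k <= max_prob R B x.
  apply: ub_le_sup; first by exists (prob_dot R B x k0).
  by exists k.
split=> //; exists k0; apply/eqP; rewrite eq_le le_sup andbT.
by apply: ge_sup => //; exists (prob_dot R B x k0), k0.
Qed.

(* Main.v *)
Require Import Defs.
From HB Require Import structures.
From mathcomp Require Import all_boot all_order all_algebra.
From mathcomp Require Import finmap.
From mathcomp Require Import complex ring lra zify.
From mathcomp Require Import boolp classical_sets functions cardinality reals exp.

Set Implicit Arguments.
Unset Strict Implicit.
Unset Printing Implicit Defensive.

Import Order.TTheory GRing.Theory Num.Theory.

Local Open Scope ring_scope.

Local Notation cmod := ComplexField.Normc.normc.

(** Reducing modulo a large prime [p], [Pr(<x, Y> = k)] is at most the average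
    over [theta] in [F_p] of the modulus of the normalised exponential sum
    [phi_x(theta) = E_Y chi(theta <x, Y>)].

    For fixed [theta], reveal the coordinates of [y] in [B] one at a time.  At a
    node whose two subtrees have comparable sizes, and at a coordinate [j] with
    [chi(2 theta d_j)] at distance at least [sigma] from [1], one of the two
    choices of [x_j] makes the sums over the two subtrees misaligned, and the
    energy [|phi|^2] drops by a factor [1 - c sigma^2].  Most leaves meet
    linearly many comparable splits, so for all but [2^(n (1 - beta + delta))]
    directions [x] the energy is [n^(-O(1))] as soon as
    [sigma^2 = K ln n / n], on average over the [theta] for which most
    coordinates satisfy the distance condition.

    The other frequencies ("light" ones) are counted by the moments of
    [D(theta) = \sum_j chi(2 theta d_j)]: many characters close to [1] force some
    [D(l theta)] with bounded [l] to be of order [n], so a moment bound gives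
    density [O(n^(-r))]; translating by multiples of one well-chosen light
    frequency and a dyadic decomposition improve this to [O(sigma n^(-r))].
    Here [r] is [0], [1] or [2]: the second moment counts the pairs with
    [d_i = d_j], the fourth one the solutions of [d_i + d_j = d_k + d_l]. *)

(** * Moduli of complex numbers *)

Section ComplexModulus.
Variable R : rcfType.
Implicit Types (z : complex R).

Definition csqr z : R := complex.Re z ^+ 2 + complex.Im z ^+ 2.

Lemma cmod_ge0 z : 0 <= cmod z.
Proof. by case: z => a b; rewrite /= sqrtr_ge0. Qed.

Lemma csqrE z : csqr z = cmod z ^+ 2.
Proof. by case: z => a b; rewrite /csqr /= sqr_sqrtr // addr_ge0 ?sqr_ge0. Qed.

Lemma csqr_ge0 z : 0 <= csqr z.
Proof. by rewrite csqrE sqr_ge0. Qed.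

Lemma cmod_nat (k : nat) : cmod (k%:R : complex R) = k%:R.
Proof. by rewrite -[k%:R]/(1 *+ k) normcMn ComplexField.Normc.normc1. Qed.

Lemma cmod_sum (I : Type) (r : seq I) (P : pred I) (f : I -> complex R) :
  cmod (\sum_(i <- r | P i) f i) <= \sum_(i <- r | P i) cmod (f i).
Proof.
elim/big_rec2: _ => [|i y x _ le_xy]; first by rewrite ComplexField.Normc.normc0.
by apply: le_trans (le_normcD _ _) _; rewrite lerD2l.
Qed.

Lemma cmodX z k : cmod (z ^+ k) = cmod z ^+ k.
Proof.
elim: k => [|k IH]; first by rewrite !expr0 ComplexField.Normc.normc1.
by rewrite !exprS ComplexField.Normc.normcM IH.
Qed.

End ComplexModulus.

(** * Sums over the Boolean cube *)

Section CubeSum.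
Variable V : nmodType.
Implicit Types f g : seq bool -> V.

(** The recursion on the first bit, over bit lists of unspecified length, unfolds in step with the
    tree recursions [expsum] and [wsum]; [cubesum_tuple] converts it into a sum over tuples. *)
Fixpoint cubesum (n : nat) f : V :=
  if n is m.+1 then
    cubesum m (fun s => f (true :: s)) + cubesum m (fun s => f (false :: s))
  else f [::].

Lemma eq_cubesum n f g : f =1 g -> cubesum n f = cubesum n g.
Proof. by elim: n f g => [|n IH] f g fg //=; congr (_ + _); apply: IH. Qed.

Lemma cubesumD n f g :
  cubesum n (fun s => f s + g s) = cubesum n f + cubesum n g.
Proof. by elim: n f g => [|n IH] f g //=; rewrite !IH addrACA. Qed.

Lemma cubesum_tuple n f : cubesum n f = \sum_(s : n.-tuple bool) f s.
Proof.
elim: n f => [|n IH] f /=.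
  rewrite (big_pred1 [tuple]) // => s; apply/esym/eqP/val_inj.
  by case: s => -[].
rewrite !IH.
pose h (s : n.+1.-tuple bool) := (thead s, [tuple of behead s]).
pose k (q : bool * n.-tuple bool) := [tuple of q.1 :: q.2].
have hk : cancel k h by case=> b s; congr pair; apply: val_inj.
have kh : cancel h k by move=> s; rewrite [RHS]tuple_eta; apply: val_inj.
rewrite [RHS](reindex k) /=; last by exists h => ? _; [exact: hk | exact: kh].
rewrite -(pair_big xpredT xpredT (fun b (s : n.-tuple bool) => f (b :: s))) /=.
by rewrite big_bool.
Qed.

End CubeSum.

Lemma cubesumZ (R : pzRingType) n (a : R) f :
  cubesum n (fun s => a * f s) = a * cubesum n f.
Proof. by elim: n f => [|n IH] f //=; rewrite !IH mulrDr. Qed.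

Section CubeSumOrder.
Variable R : realDomainType.
Implicit Types f g : seq bool -> R.

Lemma ler_cubesum n f g :
  (forall s, f s <= g s) -> cubesum n f <= cubesum n g.
Proof. by elim: n f g => [|n IH] f g le_fg //=; rewrite lerD ?IH. Qed.

End CubeSumOrder.

(** * Energy loss along the tree of prefixes of [B] *)

Section SplittingTree.
Variable R : rcfType.
Local Notation C := (complex R).
Implicit Types (c : C * C) (cs : seq (C * C)) (B : seq bool -> bool).
Implicit Types (x : seq bool) (rho t lam sig X : R).

Definition sel c (b : bool) : C := if b then c.1 else c.2.

Definition subtree B (b : bool) : seq bool -> bool := fun s => B (b :: s).

Definition tcard n B : R := cubesum n (fun s => (B s)%:R).

(* With [sel (nth c j) x_j = chi (theta x_j)], this is the exponential sum
   [\sum_(y in B) chi (theta <x, y>)], where [true] and [false] in [y] stand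
   for the signs [1] and [-1]. *)
Fixpoint expsum cs B x : C :=
  if cs is c :: cs' then
    sel c (head false x) * expsum cs' (subtree B true) (behead x)
    + (sel c (head false x))^-1 * expsum cs' (subtree B false) (behead x)
  else (B [::])%:R.

Variables (lam sig : R).

Definition balanced n B :=
  (lam * tcard n.+1 B <= tcard n (subtree B true)) &&
  (lam * tcard n.+1 B <= tcard n (subtree B false)).

(** For the pair [(chi (theta u_j), chi (theta v_j))] this is the distance of [chi (2 theta d_j)]
    from [1]. Squares occur because the two subtree sums carry [z] and [z^-1]. *)
Definition gap c := cmod (c.1 ^+ 2 - c.2 ^+ 2).

Definition heavy c := sig <= gap c.

(** With [r], [l] the subtree sizes, [FR], [FL] the subtree sums and [z] the selected unit, this is
    [|r z^-1 FL - l z FR|], the remainder term in Cauchy-Schwarz at the node (multiplied inside by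
    [z], of modulus 1). *)
Definition defect c cs B x :=
  cmod ((tcard (size cs) (subtree B true))%:C%C
          * expsum cs (subtree B false) (behead x)
        - (tcard (size cs) (subtree B false))%:C%C
          * sel c (head false x) ^+ 2
          * expsum cs (subtree B true) (behead x)).

(** A node where the energy provably drops: the defect is comparable to the gap times each
    size-weighted subtree modulus. *)
Definition hit c cs B x :=
  [&& balanced (size cs) B, heavy c,
   gap c * (tcard (size cs) (subtree B true)
            * cmod (expsum cs (subtree B false) (behead x)))
     <= 2 * defect c cs B x
 & gap c * (tcard (size cs) (subtree B false)
            * cmod (expsum cs (subtree B true) (behead x)))
     <= 2 * defect c cs B x].

(* The sum over the leaves [y] of [B] of the product of the weights [w] along
   the path to [y]. *)
Fixpoint wsum (w : bool -> bool -> R) cs B x : R :=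
  if cs is c :: cs' then
    w (balanced (size cs') B) (hit c cs' B x) *
    (wsum w cs' (subtree B true) (behead x)
     + wsum w cs' (subtree B false) (behead x))
  else (B [::])%:R.

(** For a leaf with [b] balanced nodes and [k] hits on its path, the products of these three weights
    are [rho^k], [2^(-b/2)] and [2^(b/2) t^k]. The last two serve as Markov weights, for leaves with
    few balanced nodes and for leaves with many balanced nodes but few hits. *)
Definition decay rho (b h : bool) : R := if h then rho else 1.
Definition spread (b h : bool) : R := if b then (Num.sqrt 2)^-1 else 1.
Definition tilt t (b h : bool) : R :=
  (if b then Num.sqrt 2 else 1) * (if h then t else 1).

Definition unimodular cs :=
  forall c, c \in cs -> cmod c.1 = 1 /\ cmod c.2 = 1.

Lemma tcardS n B :
  tcard n.+1 B = tcard n (subtree B true) + tcard n (subtree B false).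
Proof. by []. Qed.

Lemma tcard_ge0 n B : 0 <= tcard n B.
Proof. by elim: n B => [|n IH] B /=; rewrite ?tcardS ?addr_ge0 ?ler0n. Qed.

Lemma wsum_ge0 w cs B x : (forall b h, 0 <= w b h) -> 0 <= wsum w cs B x.
Proof.
by move=> w0; elim: cs B x => [|c cs IH] B x /=; rewrite ?ler0n // mulr_ge0 ?addr_ge0.
Qed.

Lemma wsum_decay_le rho cs B x : 0 <= rho -> rho <= 1 ->
  wsum (decay rho) cs B x <= tcard (size cs) B.
Proof.
move=> rho0 rho1; elim: cs B x => [|c cs IH] B x //=; rewrite tcardS.
set L := wsum _ _ _ _; set L' := wsum _ _ _ _.
have d0 b h : 0 <= decay rho b h by rewrite /decay; case: h.
have LL : 0 <= L + L' by apply: addr_ge0; apply: wsum_ge0.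
apply: (@le_trans _ _ (L + L')); last exact: (lerD (IH _ _) (IH _ _)).
by rewrite /decay; case: ifP => _; rewrite ?mul1r ?ler_piMl.
Qed.

Lemma hit_balanced c cs B x : hit c cs B x -> balanced (size cs) B.
Proof. by case/and4P. Qed.

(** Leaf by leaf: with [k >= G] hits the weight is at most [rho^G]; with fewer, [1 <= Y + Y^-1] for
    [Y = X 2^(-b/2)], and [t^(k - G) >= 1] lets the tilted term pay for [Y^-1]. Both [X] and [G]
    vary in the induction. *)
Lemma wsum_decay_split rho t cs B x (G : nat) X :
    0 < rho -> rho <= 1 -> 0 < t -> t <= 1 -> 0 < X ->
  wsum (decay rho) cs B x <=
    rho ^+ G * tcard (size cs) B + X * wsum spread cs B x
    + X^-1 * (t ^- G * wsum (tilt t) cs B x).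
Proof.
move=> rho0 rho1 t0 t1.
have s2 : 0 < Num.sqrt 2 :> R by rewrite sqrtr_gt0 ltr0n.
have spread0 b h : 0 <= spread b h by rewrite /spread; case: b; rewrite ?invr_ge0 ?ltW.
have tilt0 b h : 0 <= tilt t b h.
  by rewrite /tilt; case: b; case: h; rewrite ?mulr_ge0 // ltW.
have Xone (Y : R) : 0 < Y -> 1 <= Y + Y^-1.
  move=> Y0; case: (lerP 1 Y) => Y1.
    by apply: ler_wpDr => //; rewrite invr_ge0 ltW.
  apply: ler_wpDl; first exact: ltW.
  by rewrite invf_ge1 // ltW.
elim: cs B x G X => [|c cs IH] B x G X X0.
  case: G => [|G] /=.
    rewrite expr0 mul1r /= -addrA ler_wpDr //.
    by rewrite expr0 invr1 mul1r addr_ge0 ?mulr_ge0 ?invr_ge0 ?(ltW X0) ?ler0n.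
  rewrite /tcard /=; case: (B [::]) => /=; last by rewrite !mulr0 !addr0.
  rewrite !mulr1 -addrA ler_wpDl ?exprn_ge0 ?(ltW rho0) //.
  apply: le_trans (Xone X X0) _; rewrite lerD2l ler_peMr ?invr_ge0 ?(ltW X0) //.
  by rewrite invf_ge1 ?exprn_gt0 // exprn_ile1 // ltW.
case: G => [|G].
  rewrite expr0 mul1r expr0 invr1 mul1r -addrA.
  apply: le_trans (wsum_decay_le (c :: cs) B x (ltW rho0) rho1) _.
  have Q0 := wsum_ge0 (c :: cs) B x spread0.
  have T0 := wsum_ge0 (c :: cs) B x tilt0.
  by rewrite lerDl addr_ge0 // mulr_ge0 ?invr_ge0 // ltW.
rewrite [wsum _ _ _ _]/= [wsum spread _ _ _]/= [wsum (tilt t) _ _ _]/= [size _]/= tcardS.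
set b := balanced _ _; set h := hit _ _ _ _.
have hb : h -> b by exact: hit_balanced.
set QT := wsum spread _ _ _; set QF := wsum spread _ _ _.
set TT := wsum (tilt t) _ _ _; set TF := wsum (tilt t) _ _ _.
set NT := tcard _ _; set NF := tcard _ _.
have tn0 : t != 0 by rewrite gt_eqF.
have Xn0 : X != 0 by rewrite gt_eqF.
have s2n0 : Num.sqrt 2 != 0 :> R by rewrite gt_eqF.
case: (boolP h) => hh.
  have bb := hb hh; rewrite bb /decay /spread /tilt.
  (* A balanced node moves a factor [sqrt 2] into the threshold [X]; a hit moreover uses up one of
     the [G] required hits. *)
  have X'0 : 0 < X / Num.sqrt 2 by rewrite divr_gt0.
  apply: le_trans (ler_wpM2l (ltW rho0)
    (lerD (IH (subtree B true) (behead x) G _ X'0)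
          (IH (subtree B false) (behead x) G _ X'0))) _.
  rewrite -/QT -/QF -/TT -/TF -/NT -/NF.
  pose Z := X * ((Num.sqrt 2)^-1 * (QT + QF))
    + X^-1 * (t ^- G.+1 * (Num.sqrt 2 * t * (TT + TF))).
  have Z0 : 0 <= Z.
    rewrite ?(addr_ge0, mulr_ge0, invr_ge0, exprn_ge0) ?(ltW X0, ltW s2, ltW t0) //; exact: wsum_ge0.
  have -> : rho * (rho ^+ G * NT + X / Num.sqrt 2 * QT
      + (X / Num.sqrt 2)^-1 * (t ^- G * TT)
      + (rho ^+ G * NF + X / Num.sqrt 2 * QF
      + (X / Num.sqrt 2)^-1 * (t ^- G * TF)))
    = rho ^+ G.+1 * (NT + NF) + rho * Z.
    rewrite /Z !exprS; field.
    by rewrite ?tn0 ?Xn0 ?s2n0 ?expf_neq0.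
  by rewrite -addrA lerD2l ler_piMl.
have tG1 : 1 <= t ^- G.+1 by rewrite invf_ge1 ?exprn_gt0 // exprn_ile1 // ltW.
case: (boolP b) => bb; rewrite /decay /spread /tilt ?mulr1 mul1r.
  have X'0 : 0 < X / Num.sqrt 2 by rewrite divr_gt0.
  apply: le_trans (lerD (IH (subtree B true) (behead x) G.+1 _ X'0)
          (IH (subtree B false) (behead x) G.+1 _ X'0)) _.
  rewrite -/QT -/QF -/TT -/TF -/NT -/NF.
  rewrite le_eqVlt; apply/orP; left; apply/eqP; field.
  by rewrite ?tn0 ?Xn0 ?s2n0 ?expf_neq0.
apply: le_trans (lerD (IH (subtree B true) (behead x) G.+1 _ X0)
        (IH (subtree B false) (behead x) G.+1 _ X0)) _.
rewrite -/QT -/QF -/TT -/TF -/NT -/NF.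
by rewrite !mul1r le_eqVlt; apply/orP; left; apply/eqP; ring.
Qed.

(** Cauchy-Schwarz with weights [l] and [r], stated without divisions so that empty subtrees are
    covered. *)
Lemma csqr_sum2 (A D : C) (l r SL SR : R) :
    0 <= l -> 0 <= r -> 0 <= SL -> 0 <= SR ->
    csqr A <= l * SL -> csqr D <= r * SR ->
  csqr (A + D) <= (l + r) * (SL + SR).
Proof.
move=> l0 r0 SL0 SR0; rewrite !csqrE => hA hD.
set a := cmod A in hA *; set d := cmod D in hD *.
have a0 : 0 <= a by exact: cmod_ge0.
have d0 : 0 <= d by exact: cmod_ge0.
have h1 : cmod (A + D) ^+ 2 <= (a + d) ^+ 2.
  by rewrite ler_pXn2r ?nnegrE ?addr_ge0 ?cmod_ge0 ?le_normcD.
apply: le_trans h1 _.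
have h2 : 2 * (a * d) <= l * SR + r * SL.
  rewrite -(@ler_pXn2r _ 2) ?nnegrE ?mulr_ge0 ?addr_ge0 ?mulr_ge0 //.
  have h3 : (a ^+ 2) * (d ^+ 2) <= (l * SL) * (r * SR).
    by rewrite ler_pM ?sqr_ge0.
  have := sqr_ge0 (l * SR - r * SL); nra.
nra.
Qed.

(** Cauchy-Schwarz with its exact remainder [|r A - l D|^2]. The last two hypotheses bound this
    remainder from below by the two energies, and balance turns that into a fraction [lam sig^2 / 8]
    of the main term. *)
Lemma csqr_sum2_defect (A D : C) (l r SL SR rho s : R) :
    0 <= l -> 0 <= r -> 0 <= SL -> 0 <= SR -> 0 < lam -> 0 <= sig ->
    0 <= rho -> 1 - lam * sig ^+ 2 / 8 <= rho ->
    csqr A <= l * SL -> csqr D <= r * SR ->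
    lam * (r + l) <= r -> lam * (r + l) <= l -> sig <= s ->
    s * (r * cmod A) <= 2 * cmod (r%:C%C * A - l%:C%C * D) ->
    s * (l * cmod D) <= 2 * cmod (r%:C%C * A - l%:C%C * D) ->
  csqr (A + D) <= (l + r) * (rho * (SL + SR)).
Proof.
move=> l0 r0 SL0 SR0 lam0 sig0 rho0 hrho hA hD br bl hs h1 h2.
set W := cmod (_ - _) in h1 h2; have W0 : 0 <= W by exact: cmod_ge0.
have s0 : 0 <= s by apply: le_trans hs.
have [lr0|lr0] := eqVneq (r + l) 0.
  have /andP[/eqP r00 /eqP l00] : (r == 0) && (l == 0) by rewrite -paddr_eq0 // lr0.
  have := csqr_sum2 l0 r0 SL0 SR0 hA hD.
  by rewrite l00 r00 addr0 !mul0r.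
have lr : 0 < r + l by rewrite lt_neqAle eq_sym lr0 addr_ge0.
have rp : 0 < r by apply: lt_le_trans br; rewrite mulr_gt0.
have lp : 0 < l by apply: lt_le_trans bl; rewrite mulr_gt0.
have key : l * r * csqr (A + D) = (l + r) * (r * csqr A + l * csqr D) - W ^+ 2.
  rewrite /W -csqrE /csqr; case: (A) => a1 a2; case: (D) => d1 d2; simpc => /=; ring.
move: hA hD h1 h2 key; rewrite !csqrE.
set a := cmod A; set d := cmod D; set e := cmod (A + D) => hA hD h1 h2 key.
have a0 : 0 <= a by exact: cmod_ge0.
have d0 : 0 <= d by exact: cmod_ge0.
have sq1 : sig ^+ 2 * (r ^+ 2 * a ^+ 2) <= 4 * W ^+ 2.
  have : (sig * (r * a)) ^+ 2 <= (2 * W) ^+ 2.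
    rewrite ler_pXn2r ?nnegrE ?mulr_ge0 ?(ltW rp) //.
    by apply: le_trans h1; rewrite ler_wpM2r ?mulr_ge0 ?(ltW rp).
  by rewrite !exprMn -natrX.
have sq2 : sig ^+ 2 * (l ^+ 2 * d ^+ 2) <= 4 * W ^+ 2.
  have : (sig * (l * d)) ^+ 2 <= (2 * W) ^+ 2.
    rewrite ler_pXn2r ?nnegrE ?mulr_ge0 ?(ltW lp) //.
    by apply: le_trans h2; rewrite ler_wpM2r ?mulr_ge0 ?(ltW lp).
  by rewrite !exprMn -natrX.
(* The weighted energies [al = a^2/l] and [be = d^2/r] control [SL] and [SR]. *)
pose al := a ^+ 2 / l; pose be := d ^+ 2 / r.
have alE : a ^+ 2 = l * al by rewrite /al mulrC divfK ?gt_eqF.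
have beE : d ^+ 2 = r * be by rewrite /be mulrC divfK ?gt_eqF.
have al0 : 0 <= al by rewrite divr_ge0 ?sqr_ge0.
have be0 : 0 <= be by rewrite divr_ge0 ?sqr_ge0.
have alS : al <= SL by rewrite -(ler_pM2l lp) -alE.
have beS : be <= SR by rewrite -(ler_pM2l rp) -beE.
pose V := W ^+ 2 / (l * r).
have VE : W ^+ 2 = l * r * V by rewrite /V mulrC divfK // gt_eqF ?mulr_gt0.
have eE : e ^+ 2 = (l + r) * (al + be) - V.
  apply: (@mulfI _ (l * r)); first by rewrite gt_eqF ?mulr_gt0.
  by rewrite key alE beE VE; ring.
have v1 : sig ^+ 2 * (r * al) <= 4 * V.
  rewrite -(@ler_pM2l _ (l * r)) ?mulr_gt0 //.
  by move: sq1; rewrite alE VE; congr (_ <= _); ring.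
have v2 : sig ^+ 2 * (l * be) <= 4 * V.
  rewrite -(@ler_pM2l _ (l * r)) ?mulr_gt0 //.
  by move: sq2; rewrite beE VE; congr (_ <= _); ring.
have v3 : sig ^+ 2 * (lam * (r + l) * (al + be)) <= 8 * V.
  rewrite mulrDr mulrDr; have -> : (8 : R) = 4 + 4 by ring.
  rewrite [leRHS]mulrDl lerD //.
    by apply: le_trans v1; rewrite ler_wpM2l ?sqr_ge0 // ler_wpM2r.
  by apply: le_trans v2; rewrite ler_wpM2l ?sqr_ge0 // ler_wpM2r.
have v4 : e ^+ 2 <= (l + r) * ((1 - lam * sig ^+ 2 / 8) * (al + be)).
  rewrite eE -subr_ge0; have -> : (l + r) * ((1 - lam * sig ^+ 2 / 8) * (al + be)) -
    ((l + r) * (al + be) - V) = (8 * V - sig ^+ 2 * (lam * (r + l) * (al + be))) / 8.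
    by field.
  by rewrite divr_ge0 ?subr_ge0.
apply: (le_trans v4); rewrite ler_wpM2l ?addr_ge0 //.
apply: (@le_trans _ _ (rho * (al + be))); first by rewrite ler_wpM2r ?addr_ge0.
by rewrite ler_wpM2l ?lerD.
Qed.

Lemma sel_mod c b : cmod c.1 = 1 /\ cmod c.2 = 1 -> cmod (sel c b) = 1.
Proof. by case: b => -[]. Qed.

(** Induction along the tree: weighted Cauchy-Schwarz at every node, improved by the factor [rho] at
    each hit. *)
Lemma csqr_expsum_le rho cs B x :
    0 < lam -> 0 <= sig -> 0 <= rho -> 1 - lam * sig ^+ 2 / 8 <= rho ->
    unimodular cs ->
  csqr (expsum cs B x) <= tcard (size cs) B * wsum (decay rho) cs B x.
Proof.
move=> lam0 sig0 rho0 hrho; elim: cs B x => [|c cs IH] B x hcs /=.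
  by rewrite /tcard /=; case: (B _); rewrite /csqr /=; lra.
have hc : cmod c.1 = 1 /\ cmod c.2 = 1 by apply: hcs; rewrite mem_head.
have hcs' : unimodular cs by move=> d hd; apply: hcs; rewrite inE hd orbT.
have d0 b h : 0 <= decay rho b h by rewrite /decay; case: h.
set z := sel c _; have z1 : cmod z = 1 by apply: sel_mod.
have z0 : z != 0.
  by apply/eqP => z0; move: z1; rewrite z0 ComplexField.Normc.normc0 => /eqP; rewrite eq_sym oner_eq0.
have zV1 : cmod z^-1 = 1 by rewrite ComplexField.Normc.normcV z1 invr1.
have uni (e f : C) : cmod e = 1 -> csqr (e * f) = csqr f.
  by rewrite !csqrE ComplexField.Normc.normcM => ->; rewrite mul1r.
have hR := IH (subtree B true) (behead x) hcs'.
have hL := IH (subtree B false) (behead x) hcs'.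
rewrite -(uni z _ z1) in hR; rewrite -(uni z^-1 _ zV1) in hL.
have r0 := tcard_ge0 (size cs) (subtree B true).
have l0 := tcard_ge0 (size cs) (subtree B false).
have SR0 := wsum_ge0 cs (subtree B true) (behead x) d0.
have SL0 := wsum_ge0 cs (subtree B false) (behead x) d0.
rewrite [X in csqr X]addrC.
rewrite tcardS [_ + tcard _ _]addrC [wsum _ _ _ _ + _]addrC /decay.
case: ifP => [|_]; last by rewrite mul1r; apply: csqr_sum2.
case/and4P => /andP[b1 b2] hv g1 g2.
have WE : defect c cs B x = cmod ((tcard (size cs) (subtree B true))%:C%C *
   (z^-1 * expsum cs (subtree B false) (behead x)) -
   (tcard (size cs) (subtree B false))%:C%C *
   (z * expsum cs (subtree B true) (behead x))).
  rewrite -[RHS]mul1r -z1 -ComplexField.Normc.normcM /defect -/z; congr cmod.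
  by field.
rewrite WE in g1 g2.
have c1 (e f : C) : cmod e = 1 -> cmod (e * f) = cmod f.
  by rewrite ComplexField.Normc.normcM => ->; rewrite mul1r.
by apply: (csqr_sum2_defect (s := gap c)) => //; rewrite c1.
Qed.

Lemma sqrtrD_sqrt2 (a b : R) : 0 <= a -> 0 <= b ->
  Num.sqrt a + Num.sqrt b <= Num.sqrt 2 * Num.sqrt (a + b).
Proof.
move=> a0 b0; rewrite -(@ler_pXn2r _ 2) ?nnegrE ?addr_ge0 ?mulr_ge0 ?sqrtr_ge0 //.
rewrite exprMn !sqr_sqrtr ?addr_ge0 ?ler0n // sqrrD !sqr_sqrtr //.
have := sqr_ge0 (Num.sqrt a - Num.sqrt b); rewrite sqrrB !sqr_sqrtr //; lra.
Qed.

Lemma sqrtrD_unbalanced (a b : R) : 0 <= a -> 0 <= b -> 0 <= lam ->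
    (a < lam * (a + b)) || (b < lam * (a + b)) ->
  Num.sqrt a + Num.sqrt b <= (1 + Num.sqrt lam) * Num.sqrt (a + b).
Proof.
move=> a0 b0 lam0 h; rewrite mulrDl mul1r -sqrtrM //.
case/orP: h => h; first rewrite addrC.
all: by rewrite lerD // ler_wsqrtr ?lerDl ?lerDr // ltW.
Qed.

(** Induction on square roots of sizes. At a balanced node the weight [2^(-1/2)] exactly absorbs the
    loss in [sqrt a + sqrt b <= sqrt 2 sqrt (a + b)]; at an unbalanced one a child is so small that
    only [1 + sqrt lam] is lost. Hence few leaves have few balanced nodes. *)
Lemma wsum_spread_le cs B x : 0 <= lam ->
  wsum spread cs B x <=
    Num.sqrt (tcard (size cs) B) * (1 + Num.sqrt lam) ^+ size cs.
Proof.
move=> lam0; have sl0 : 0 <= Num.sqrt lam :> R by rewrite sqrtr_ge0.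
elim: cs B x => [|c cs IH] B x /=.
  by rewrite /tcard /= expr0 mulr1; case: (B _); rewrite ?sqrtr1 ?sqrtr0.
set b := balanced _ _; set P := (1 + _) ^+ size cs in IH.
have P0 : 0 <= P by rewrite exprn_ge0 ?addr_ge0.
have sp0 : 0 <= spread b (hit c cs B x).
  by rewrite /spread; case: b => //; rewrite invr_ge0 sqrtr_ge0.
apply: le_trans (ler_wpM2l sp0 (lerD (IH (subtree B true) (behead x))
                                     (IH (subtree B false) (behead x)))) _.
rewrite -mulrDl mulrA exprS mulrA ler_wpM2r //.
set r := tcard _ _; set l := tcard _ _.
have [bb|bb] := boolP b; rewrite /spread ?bb ?(negPf bb).
  apply: (@le_trans _ _ (Num.sqrt (r + l))); last first.
    by rewrite tcardS ler_peMr ?sqrtr_ge0 ?lerDl.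
  by rewrite mulrC ler_pdivrMr ?sqrtr_gt0 // mulrC sqrtrD_sqrt2 ?tcard_ge0.
rewrite mul1r mulrC tcardS; apply: sqrtrD_unbalanced; rewrite ?tcard_ge0 //.
by move: bb; rewrite /b /balanced negb_and -!ltNge tcardS.
Qed.

(** Eliminating one subtree sum between the expressions for the two values of the bit leaves
    [c.1 ^+ 2 - c.2 ^+ 2] times the other. So the two defects add up to at least both required
    quantities, and the larger defect is a hit. *)
Lemma hit_or c cs B x : cmod c.1 = 1 /\ cmod c.2 = 1 ->
    balanced (size cs) B -> heavy c ->
  hit c cs B (true :: x) || hit c cs B (false :: x).
Proof.
case=> c1 c2 hb hv; rewrite /hit hb hv /=.
set r := tcard _ _; set l := tcard _ _.
set FL := expsum _ _ _; set FR := expsum _ _ _.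
set WT := defect _ _ _ _; set WF := defect _ _ _ _.
have l0 : 0 <= l by exact: tcard_ge0.
have r0 : 0 <= r by exact: tcard_ge0.
have cR (a : R) : 0 <= a -> cmod a%:C%C = a.
  by move=> a0; rewrite /= expr0n /= addr0 sqrtr_sqr ger0_norm.
have M := ComplexField.Normc.normcM.
have hl : gap c * (l * cmod FR) <= WT + WF.
  rewrite -[X in X * cmod FR](cR l l0) -!M /WT /WF /defect -/r -/l -/FL -/FR /=.
  rewrite -(normcN (_ - _ * c.1 ^+ 2 * _)); apply: le_trans (le_normcD _ _).
  by rewrite le_eqVlt; apply/orP; left; apply/eqP; congr cmod; ring.
have hr : gap c * (r * cmod FL) <= WT + WF.
  rewrite -[X in X * cmod FL](cR r r0) -!M.
  have -> : WT = cmod (c.2 ^+ 2 * (r%:C%C * FL - l%:C%C * c.1 ^+ 2 * FR)).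
    by rewrite M cmodX c2 expr1n mul1r.
  have -> : WF = cmod (c.1 ^+ 2 * (r%:C%C * FL - l%:C%C * c.2 ^+ 2 * FR)).
    by rewrite M cmodX c1 expr1n mul1r.
  rewrite -(normcN (c.2 ^+ 2 * _)); apply: le_trans (le_normcD _ _).
  by rewrite le_eqVlt; apply/orP; left; apply/eqP; congr cmod; ring.
by have [h|/ltW h] := lerP WF WT; apply/orP; [left|right]; apply/andP; split; lra.
Qed.

(** Summing over the directions: at a balanced heavy node one value of the bit is a hit by [hit_or],
    so the two hit factors add up to at most [1 + t]. Elsewhere the trivial [2] is used; the factor
    thus lost at light coordinates is the final power of [2]. *)
Lemma cubesum_tilt_le t cs B : 0 <= lam -> 0 <= t -> t <= 1 -> unimodular cs ->
  cubesum (size cs) (wsum (tilt t) cs B) <=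
    Num.sqrt (tcard (size cs) B) * (2 * (1 + t) * (1 + Num.sqrt lam)) ^+ size cs
    * 2 ^+ count (predC heavy) cs.
Proof.
move=> lam0 t0 t1; have sl0 : 0 <= Num.sqrt lam :> R by rewrite sqrtr_ge0.
have s20 : 0 < Num.sqrt 2 :> R by rewrite sqrtr_gt0 ltr0n.
elim: cs B => [|c cs IH] B hcs.
  by rewrite /tcard /= !expr0 !mulr1; case: (B _); rewrite ?sqrtr1 ?sqrtr0.
have hc : cmod c.1 = 1 /\ cmod c.2 = 1 by apply: hcs; rewrite mem_head.
have hcs' : unimodular cs by move=> d hd; apply: hcs; rewrite inE hd orbT.
have tilt0 b h : 0 <= tilt t b h.
  by rewrite /tilt; case: b; case: h; rewrite ?mulr_ge0 // ltW.
set b := balanced (size cs) B.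
(* Bounds the sum of the weights at the root over the two values of the first bit. *)
pose f := (if heavy c && b then 1 + t else 2) * (if b then Num.sqrt 2 else 1).
pose TR s := wsum (tilt t) cs (subtree B true) s.
pose TL s := wsum (tilt t) cs (subtree B false) s.
rewrite [size _]/= [cubesum _ _]/= -cubesumD.
apply: (@le_trans _ _ (f * cubesum (size cs) (fun s => TR s + TL s))).
  rewrite -cubesumZ; apply: ler_cubesum => s; rewrite -mulrDl -/(TR s) -/(TL s).
  have S0 : 0 <= TR s + TL s by apply: addr_ge0; apply: wsum_ge0.
  apply: ler_wpM2r => //; rewrite /tilt -/b -mulrDr mulrC /f.
  apply: ler_wpM2r; first by case: (b) => //; exact: ltW.
  case: (boolP (heavy c && b)) => [/andP[hv bb]|/negPf hvb].
    case/orP: (hit_or s hc bb hv) => ->; first by rewrite addrC; case: ifP; lra.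
    by case: ifP; lra.
  have nh x : hit c cs B x = false by rewrite /hit -/b andbA [b && _]andbC hvb.
  by rewrite !nh; lra.
rewrite cubesumD.
set r := tcard (size cs) (subtree B true); set l := tcard (size cs) (subtree B false).
set kap := 2 * (1 + t) * (1 + Num.sqrt lam).
set Z := kap ^+ size cs * 2 ^+ count (predC heavy) cs.
have kap2 : 2 <= kap by rewrite /kap; nra.
have Z0 : 0 <= Z by rewrite mulr_ge0 ?exprn_ge0 //; lra.
have f0 : 0 <= f by rewrite /f; apply: mulr_ge0; case: ifP => _ //; lra.
apply: (@le_trans _ _ (f * ((Num.sqrt r + Num.sqrt l) * Z))).
  rewrite ler_wpM2l // mulrDl /Z !mulrA lerD //; exact: IH.
have r0 : 0 <= r by exact: tcard_ge0.
have l0 : 0 <= l by exact: tcard_ge0.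
have q0 : 0 <= Num.sqrt (r + l) by rewrite sqrtr_ge0.
have -> : Num.sqrt (tcard (size cs).+1 B) * kap ^+ (size cs).+1 *
    2 ^+ count (predC heavy) (c :: cs)
  = Num.sqrt (r + l) * kap * 2 ^+ (~~ heavy c) * Z.
  by rewrite /= tcardS -/r -/l exprD exprS /Z; ring.
rewrite mulrA; apply: ler_wpM2r => //.
have h2 : 1 <= 2 ^+ (~~ heavy c) :> R by case: (heavy c); rewrite ?expr0 ?expr1; lra.
have [bb|bb] := boolP b; rewrite /f ?bb ?(negPf bb) ?andbT ?andbF ?mulr1.
  have h := sqrtrD_sqrt2 r0 l0.
  have s22 : Num.sqrt 2 * Num.sqrt 2 = 2 :> R by rewrite -expr2 sqr_sqrtr ?ler0n.
  apply: (@le_trans _ _ ((if heavy c then 1 + t else 2) * 2 * Num.sqrt (r + l))).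
    set e := if heavy c then _ else _.
    have e0 : 0 <= e by rewrite /e; case: (heavy c); lra.
    have -> : e * 2 * Num.sqrt (r + l) = e * (Num.sqrt 2 * (Num.sqrt 2 * Num.sqrt (r + l))).
      by rewrite [Num.sqrt 2 * _]mulrA s22 mulrA.
    by rewrite -mulrA; apply: ler_wpM2l => //; rewrite ler_wpM2l // ltW.
  rewrite [leRHS](_ : _ = kap * 2 ^+ (~~ heavy c) * Num.sqrt (r + l)); last by ring.
  apply: ler_wpM2r => //.
  case: (heavy c); rewrite /= ?expr0 ?expr1 ?mulr1; last by lra.
  by rewrite mulrC /kap ler_peMr ?lerDl //; lra.
have h : Num.sqrt r + Num.sqrt l <= (1 + Num.sqrt lam) * Num.sqrt (r + l).
  apply: sqrtrD_unbalanced => //.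
  by move: bb; rewrite /b /balanced negb_and -!ltNge tcardS.
apply: (@le_trans _ _ (2 * ((1 + Num.sqrt lam) * Num.sqrt (r + l)))).
  by rewrite ler_wpM2l.
rewrite [leRHS](_ : _ = kap * 2 ^+ (~~ heavy c) * Num.sqrt (r + l)); last by ring.
rewrite mulrA; apply: ler_wpM2r => //.
have : 2 * (1 + Num.sqrt lam) <= kap by rewrite /kap; nra.
nra.
Qed.

End SplittingTree.

(** * Frequencies at which many characters are close to 1 *)

Section SmallCharacters.
Variable R : rcfType.
Local Notation C := (complex R).

Lemma cmod1B_exp (z : C) l : cmod z = 1 -> cmod (1 - z ^+ l) <= l%:R * cmod (1 - z).
Proof.
move=> z1; elim: l => [|l IH].
  by rewrite expr0 subrr ComplexField.Normc.normc0 mul0r.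
have -> : 1 - z ^+ l.+1 = (1 - z ^+ l) + z ^+ l * (1 - z) by rewrite exprSr; ring.
apply: le_trans (le_normcD _ _) _.
by rewrite ComplexField.Normc.normcM cmodX z1 expr1n mul1r -natr1 mulrDl mul1r lerD2r.
Qed.

Lemma cmod_geom_ge (z : C) M : cmod z = 1 -> M%:R * cmod (1 - z) <= 1 / 2 ->
  M%:R / 2 <= cmod (\sum_(l < M) z ^+ l).
Proof.
move=> z1 hM.
have h1 : cmod (\sum_(l < M) (1 - z ^+ l)) <= M%:R * (1 / 2).
  apply: le_trans (cmod_sum _ _ _) _.
  rewrite [leRHS](_ : _ = \sum_(l < M) (1 / 2 : R)); last first.
    by rewrite sumr_const card_ord mulr_natl.
  apply: ler_sum => l _; apply: le_trans (cmod1B_exp _ z1) _.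
  apply: le_trans hM; rewrite ler_wpM2r ?cmod_ge0 // ler_nat ltnW //.
have h2 : (M%:R : R) <= cmod (\sum_(l < M) (1 - z ^+ l)) + cmod (\sum_(l < M) z ^+ l).
  apply: le_trans (le_normcD _ _).
  by rewrite -big_split /= (eq_bigr (fun _ => 1)) ?sumr_const ?card_ord ?cmod_nat // => i _; rewrite subrK.
lra.
Qed.

Lemma csqr_sum_unit (M : nat) (z : 'I_M -> C) : (forall l, cmod (z l) = 1) ->
  (csqr (\sum_l z l))%:C%C = \sum_l \sum_l' z l / z l'.
Proof.
move=> z1.
have conj_inv l : (z l)^*%C = (z l)^-1.
  by rewrite invc_norm -add_Re2_Im2 -/(csqr _) csqrE z1 expr1n invr1 mul1r.
rewrite /csqr add_Re2_Im2 sqr_normc rmorph_sum mulr_suml.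
apply: eq_bigr => l _; rewrite mulr_sumr; apply: eq_bigr => l' _.
by rewrite /= conj_inv.
Qed.

Variables (G : finZmodType) (n : nat) (c : 'I_n -> G -> C).
Hypothesis cD : forall j th th', c j (th + th') = c j th * c j th'.
Hypothesis c_unit : forall j th, cmod (c j th) = 1.
Hypothesis n_gt0 : (0 < n)%N.

Definition chdist j th : R := cmod (1 - c j th).

Definition charsum th : C := \sum_j c j th.

Lemma char_neq0 j th : c j th != 0.
Proof.
by apply/eqP => h; have /eqP := c_unit j th; rewrite h ComplexField.Normc.normc0 eq_sym oner_eq0.
Qed.

Lemma char0 j : c j 0 = 1.
Proof. by apply: (mulfI (char_neq0 j 0)); rewrite -cD addr0 mulr1. Qed.

Lemma charMn j th l : c j (th *+ l) = c j th ^+ l.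
Proof. by elim: l => [|l IH]; rewrite ?mulr0n ?char0 // mulrS cD IH exprS. Qed.

Lemma charN j th : c j (- th) = (c j th)^-1.
Proof.
by apply: (mulfI (char_neq0 j th)); rewrite -cD subrr char0 divff ?char_neq0.
Qed.

Lemma chdist_ge0 j th : 0 <= chdist j th. Proof. exact: cmod_ge0. Qed.

Lemma chdistD j th th' : chdist j (th + th') <= chdist j th + chdist j th'.
Proof.
rewrite /chdist cD; have -> : 1 - c j th * c j th' =
  (1 - c j th) + c j th * (1 - c j th') by ring.
by apply: le_trans (le_normcD _ _) _; rewrite ComplexField.Normc.normcM c_unit mul1r.
Qed.

Lemma chdistN j th : chdist j (- th) = chdist j th.
Proof.
rewrite /chdist charN.
have -> : 1 - (c j th)^-1 = - ((c j th)^-1 * (1 - c j th)).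
  by rewrite mulrBr mulr1 mulVf ?char_neq0 // opprB.
by rewrite normcN ComplexField.Normc.normcM ComplexField.Normc.normcV c_unit invr1 mul1r.
Qed.

Lemma chdistMn j th l : chdist j (th *+ l) <= l%:R * chdist j th.
Proof. by rewrite /chdist charMn cmod1B_exp. Qed.

(** Short multiples do not wrap around the circle: in [1 - z^h = (1 - z) (1 + z + ... + z^(h-1))]
    all terms of the second factor are within [1/2] of [1]. *)
Lemma chdistMn_ge j th h : h%:R * chdist j th <= 1 / 2 ->
  h%:R / 2 * chdist j th <= chdist j (th *+ h).
Proof.
move=> hh; rewrite /chdist charMn.
have -> : 1 - c j th ^+ h = (1 - c j th) * \sum_(i < h) c j th ^+ i.
  by rewrite -opprB subrX1 -mulNr opprB.
rewrite ComplexField.Normc.normcM mulrC.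
by rewrite ler_wpM2l ?cmod_ge0 // cmod_geom_ge.
Qed.

Definition near_trivial rho (Q : nat) :=
  [set th | (n <= Q * #|[set j | (chdist j th < rho)%R]|)%N].

(* Fejer kernel: if many [c j th] are close to [1] then
   [\sum_j |\sum_(l < M) (c j th)^l|^2] is large, so one of the character sums
   at a nonzero multiple of [th] is of order [n]. *)
Lemma near_trivial_charsum rho (Q : nat) th : (0 < Q)%N ->
    rho * (8 * Q)%:R <= 1 / 2 -> th \in near_trivial rho Q ->
  exists l l' : 'I_(8 * Q), l != l' /\
    n%:R / (8 * Q)%:R <= cmod (charsum (th *+ l - th *+ l')).
Proof.
set M := (8 * Q)%N => Q0 hrho; rewrite inE => hth.
case: (boolP [exists l : 'I_M, exists l' : 'I_M, (l != l') &&
   (n%:R / M%:R <= cmod (charsum (th *+ l - th *+ l')))]) => [|hno].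
  by move=> /existsP[l /existsP[l' /andP[h1 h2]]]; exists l, l'.
have M0 : 0 < M%:R :> R by rewrite ltr0n muln_gt0.
have n0 : 0 < n%:R :> R by rewrite ltr0n.
pose S j := \sum_(l < M) c j th ^+ l.
(* The [M] diagonal pairs contribute [n] each, the [M (M - 1)] others less than [n / M] each by
   assumption. *)
have up : \sum_j csqr (S j) <= 2 * M%:R * n%:R - n%:R.
  have SE : (\sum_j csqr (S j))%:C%C =
      \sum_(l < M) \sum_(l' < M) charsum (th *+ l - th *+ l').
    rewrite rmorph_sum /= (eq_bigr (fun j => \sum_(l < M) \sum_(l' < M)
      c j th ^+ l / c j th ^+ l')); last first.
      by move=> j _; rewrite csqr_sum_unit // => l; rewrite cmodX c_unit expr1n.
    rewrite exchange_big; apply: eq_bigr => l _; rewrite exchange_big.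
    by apply: eq_bigr => l' _; apply: eq_bigr => j _; rewrite cD charN !charMn.
  have S0 : 0 <= \sum_j csqr (S j) by apply: sumr_ge0 => j _; exact: csqr_ge0.
  have -> : \sum_j csqr (S j) = cmod ((\sum_j csqr (S j))%:C%C).
    by rewrite /= expr0n /= addr0 sqrtr_sqr ger0_norm.
  rewrite SE; apply: le_trans (cmod_sum _ _ _) _.
  apply: (@le_trans _ _ (\sum_(l < M) \sum_(l' < M)
     (n%:R / M%:R + (l == l')%:R * (n%:R - n%:R / M%:R)))); last first.
    rewrite (eq_bigr (fun _ => n%:R + (n%:R - n%:R / M%:R))); last first.
      move=> l _; rewrite big_split /= sumr_const card_ord -[_ *+ M]mulr_natr divfK ?gt_eqF //.
      rewrite (bigD1 l) //= eqxx mul1r big1 ?addr0 // => l' hl.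
      by rewrite eq_sym (negPf hl) mul0r.
    rewrite sumr_const card_ord -mulr_natr le_eqVlt; apply/orP; left; apply/eqP.
    by field; rewrite gt_eqF.
  apply: ler_sum => l _; apply: le_trans (cmod_sum _ _ _) _; apply: ler_sum => l' _.
  have [->|hl] := eqVneq l l'.
    rewrite subrr mul1r addrC subrK /charsum (eq_bigr (fun _ => 1)) ?sumr_const ?card_ord ?cmod_nat //.
    by move=> j _; exact: char0.
  rewrite mul0r addr0; move: hno; rewrite negb_exists => /forallP/(_ l).
  rewrite negb_exists => /forallP/(_ l'); rewrite hl /= -ltNge; exact: ltW.
(* At least [n / Q] indices contribute [(M / 2)^2] each; [M = 8 Q] makes this [2 M n], just above
   the upper bound. *)
have low : 2 * M%:R * n%:R <= \sum_j csqr (S j).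
  apply: (@le_trans _ _ (\sum_(j | chdist j th < rho) (M%:R / 2) ^+ 2)); last first.
    rewrite big_mkcond /=; apply: ler_sum => j _; case: ifP => hj; last exact: csqr_ge0.
    rewrite csqrE ler_pXn2r ?nnegrE ?cmod_ge0 ?divr_ge0 ?ler0n //.
    apply: cmod_geom_ge => //; apply: le_trans hrho; rewrite mulrC.
    by rewrite ler_wpM2r ?ler0n // ltW.
  rewrite sumr_const; set k := #|_|.
  have kE : k = #|[set j | (chdist j th < rho)%R]| by rewrite cardsE.
  have : n%:R <= Q%:R * k%:R :> R by rewrite -natrM ler_nat kE.
  have ME : M%:R = 8 * Q%:R :> R by rewrite natrM.
  rewrite -mulr_natr ME => hk.
  have Q0' : 0 < Q%:R :> R by rewrite ltr0n.
  nra.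
by have := le_trans low up; rewrite leNgt => /negP[]; rewrite ltrBlDr ltrDl.
Qed.

(** Markov's inequality for the [s]-th powers, summed over the at most [(8 Q)^2] pairs of multiples
    that [near_trivial_charsum] can return. *)
Lemma card_near_trivial rho (Q s : nat) (E : R) : (0 < Q)%N ->
    rho * (8 * Q)%:R <= 1 / 2 -> 0 <= E ->
    (forall l l' : nat, (l < 8 * Q)%N -> (l' < 8 * Q)%N -> l != l' ->
       \sum_th cmod (charsum (th *+ l - th *+ l')) ^+ s <= E) ->
  #|near_trivial rho Q|%:R * (n%:R / (8 * Q)%:R) ^+ s <= (8 * Q)%:R ^+ 2 * E.
Proof.
set M := (8 * Q)%N => Q0 hrho E0 hE.
pose f th (l l' : 'I_M) := cmod (charsum (th *+ l - th *+ l')) ^+ s : R.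
have f0 th l l' : 0 <= f th l l' by rewrite exprn_ge0 ?cmod_ge0.
pose b (l l' : 'I_M) : R := (l != l')%:R.
apply: (@le_trans _ _ (\sum_th \sum_l \sum_l' b l l' * f th l l')).
  rewrite mulr_natl -sumr_const big_mkcond /=; apply: ler_sum => th _.
  have nn : 0 <= \sum_l \sum_l' b l l' * f th l l'.
    by apply: sumr_ge0 => l _; apply: sumr_ge0 => l' _; rewrite mulr_ge0 ?ler0n.
  case: ifP => // hth; have [l [l' [hl hD]]] := near_trivial_charsum Q0 hrho hth.
  rewrite (bigD1 l) //= (bigD1 l') //= -addrA ler_wpDr //.
    by apply: addr_ge0; apply: sumr_ge0 => i _; rewrite ?mulr_ge0 ?ler0n //;
       apply: sumr_ge0 => i' _; rewrite mulr_ge0 ?ler0n.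
  by rewrite /b hl mul1r lerXn2r ?nnegrE ?cmod_ge0 ?divr_ge0 ?ler0n.
rewrite exchange_big /=.
apply: (@le_trans _ _ (\sum_(l < M) \sum_(l' < M) E)); last first.
  by rewrite !sumr_const card_ord -mulrnA -[leLHS]mulr_natl natrM.
apply: ler_sum => l _; rewrite exchange_big /=; apply: ler_sum => l' _.
rewrite -mulr_sumr /b; have [|hl] := boolP (l != l'); last by rewrite mul0r.
by move=> hl; rewrite mul1r; apply: hE => //; exact: ltn_ord.
Qed.

Definition annulus eps (K : nat) th :=
  [set j | (eps <= K%:R * chdist j th)%R && (chdist j th < eps)%R].

Definition annular eps (K q : nat) :=
  [set th | (n <= q * #|annulus eps K th|)%N].

Lemma sqr_sum_le (f : 'I_n -> nat) :
  ((\sum_j f j) ^ 2 <= n * \sum_j f j ^ 2)%N.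
Proof.
rewrite -(leq_pmul2l (isT : (0 < 2)%N)) -mulnn big_distrl /= big_distrr /=.
have -> : (2 * (n * \sum_j f j ^ 2) = \sum_(i < n) \sum_(j < n) (f i ^ 2 + f j ^ 2))%N.
  under [RHS]eq_bigr => i _ do rewrite big_split /= sum_nat_const card_ord.
  by rewrite big_split /= -big_distrr /= sum_nat_const card_ord mul2n addnn.
apply: leq_sum => i _; rewrite big_distrr /= big_distrr /=; apply: leq_sum => j _.
exact: (nat_Cauchy (f i) (f j)).1.
Qed.

(* Pigeonhole: some [th0] has its annulus meeting those of the other elements
   of [W] about as often as independence would predict. *)
Lemma annular_popular eps K q : annular eps K q != finset.set0 ->
  exists2 th0, th0 \in annular eps K q &
    (n * #|annular eps K q| <= q ^ 2 *
      \sum_(th in annular eps K q) #|annulus eps K th :&: annulus eps K th0|)%N.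
Proof.
set W := annular eps K q => W0.
pose N j := #|[set th in W | j \in annulus eps K th]|.
have cardE (A : {set 'I_n}) : #|A| = (\sum_j (j \in A))%N.
  by rewrite -sum1_card big_mkcond; apply: eq_bigr => j _; case: (j \in A).
have sN : (n * #|W| <= q * \sum_j N j)%N.
  have -> : (\sum_j N j = \sum_(th in W) #|annulus eps K th|)%N.
    under [RHS]eq_bigr => th _ do rewrite cardE.
    rewrite exchange_big /=; apply: eq_bigr => j _.
    rewrite /N -sum1_card big_mkcond [RHS]big_mkcond /=; apply: eq_bigr => th _.
    by rewrite inE; case: (th \in W) => //=; case: (j \in _).
  rewrite big_distrr /= mulnC -sum_nat_const; apply: leq_sum => th.
  by rewrite inE.
(* Cauchy-Schwarz over the coordinates; the second moment of [N] counts the overlaps of all pairs in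
   [W]. *)
have sN2 : (n * #|W| ^ 2 <= q ^ 2 * \sum_j N j ^ 2)%N.
  rewrite -(leq_pmul2l n_gt0) mulnA mulnn -expnMn.
  apply: (@leq_trans ((q * \sum_j N j) ^ 2)); first by rewrite leq_sqr.
  by rewrite expnMn mulnCA leq_mul2l sqr_sum_le orbT.
case: (boolP [exists th0 in W, n * #|W| <= q ^ 2 *
   \sum_(th in W) #|annulus eps K th :&: annulus eps K th0|]%N).
  by case/existsP => th0 /andP[h1 h2]; exists th0.
rewrite negb_exists => /forallP hno; exfalso; move: sN2; apply/negP; rewrite -ltnNge.
have -> : (\sum_j N j ^ 2 = \sum_(th0 in W) \sum_(th in W)
    #|annulus eps K th :&: annulus eps K th0|)%N.
  have NE j : N j = (\sum_(th in W) (j \in annulus eps K th))%N.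
    rewrite /N -sum1_card big_mkcond [RHS]big_mkcond /=; apply: eq_bigr => th _.
    by rewrite inE; case: (th \in W) => //=; case: (j \in _).
  rewrite (eq_bigr (fun j => \sum_(th0 in W) \sum_(th in W)
    (j \in annulus eps K th) * (j \in annulus eps K th0)))%N; last first.
    move=> j _; rewrite -mulnn NE big_distrr /=; apply: eq_bigr => th0 _.
    by rewrite big_distrl.
  rewrite exchange_big /=; apply: eq_bigr => th0 _.
  rewrite exchange_big /=; apply: eq_bigr => th _.
  by rewrite cardE; apply: eq_bigr => j _; rewrite finset.in_setI mulnb.
rewrite big_distrr /=; have [th1 h1] : exists th1, th1 \in W by apply/finset.set0Pn.
apply: (@leq_trans (\sum_(th0 in W) (n * #|W|))%N); last first.
  by rewrite sum_nat_const -mulnn mulnCA.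
have lt th0 : th0 \in W -> (q ^ 2 * \sum_(th in W)
    #|annulus eps K th :&: annulus eps K th0| < n * #|W|)%N.
  by move=> h; move: (hno th0); rewrite h /= -ltnNge.
rewrite (bigD1 th1) //= [ltnRHS](bigD1 th1) //= -addSn leq_add ?lt //.
by apply: leq_sum => th0 /andP[h _]; exact/ltnW/lt.
Qed.

(* A step of length at least [eps / K] cannot stay near [1] for more than
   [4 K] of the first [m] iterates, as these do not go around the circle. *)
Lemma annulus_overlap eps (K m : nat) j th0 eta : (0 < K)%N ->
    m%:R * eps <= 1 / 2 -> j \in annulus eps K th0 ->
  (#|[set l : 'I_m | (chdist j (eta - th0 *+ l) < eps)%R]| <= 4 * K)%N.
Proof.
move=> K0 hm; rewrite inE => /andP[lo hi].
have e0 : 0 < eps by apply: le_lt_trans hi; exact: chdist_ge0.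
set L := [set _ | _].
have K4 : (0 < 4 * K)%N by rewrite muln_gt0.
have close l l' : l \in L -> l' \in L -> (l' <= l)%N -> (l - l' < 4 * K)%N.
  rewrite !inE => hl hl' le_l; set h := (l - l')%N.
  have d2 : chdist j (th0 *+ h) < 2 * eps.
    have -> : th0 *+ h = (eta - th0 *+ l') + - (eta - th0 *+ l).
      by rewrite opprB addrC addrA subrK /h mulrnBr.
    apply: le_lt_trans (chdistD _ _ _) _; rewrite chdistN; lra.
  have hm' : (h <= m)%N by apply: leq_trans (leq_subr _ _) (ltnW (ltn_ord l)).
  have hh : h%:R * chdist j th0 <= 1 / 2.
    apply: le_trans hm; apply: ler_pM; rewrite ?ler0n ?chdist_ge0 ?ler_nat //.
    exact: ltW.
  have d3 := le_lt_trans (chdistMn_ge hh) d2.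
  rewrite -(ltr_nat R) natrM.
  have h0 : 0 <= h%:R :> R by rewrite ler0n.
  have k0 : 0 < K%:R :> R by rewrite ltr0n.
  have : h%:R * eps <= h%:R * (K%:R * chdist j th0) by rewrite ler_wpM2l.
  have : h%:R / 2 * chdist j th0 * K%:R < 2 * eps * K%:R by rewrite ltr_pM2r.
  move=> a1 a2; rewrite -(ltr_pM2r e0); lra.
(* Members of [L] differ by less than [4 K], so reduction modulo [4 K] is injective on [L]. *)
rewrite -[leqRHS]card_ord -(card_in_imset (f := fun l : 'I_m => Ordinal (ltn_pmod l K4))).
  exact: max_card.
move=> l l' hl hl' [] hmod; apply: val_inj => /=.
wlog le_l : l l' hl hl' hmod / (l' <= l)%N.
  move=> hw; case: (leqP l' l) => [|/ltnW] le_l; first exact: hw.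
  by symmetry; apply: hw.
have hlt := close _ _ hl hl' le_l.
have : (l - l' == 0 %[mod 4 * K])%N by rewrite eqn_mod_dvd // subn0 -eqn_mod_dvd // hmod.
by rewrite mod0n modn_small // subn_eq0 => le_l'; apply/eqP; rewrite eqn_leq le_l le_l'.
Qed.

(** Translate the annular set [W] by the multiples [l th0], [l < m], of a popular element, weighting
    [th] by its overlap with [th0]. Translates outside [U] come from small overlaps and carry at
    most half of the total weight. The rest is regrouped by its image in [U], where
    [annulus_overlap] limits how often each coordinate is counted. This gains a factor [m] over the
    size of [U]. *)
Lemma card_annular eps (K q m : nat) : (0 < K)%N -> m%:R * eps <= 1 / 2 ->
  (m * #|annular eps K q| <=
     8 * K * q ^ 2 * #|near_trivial (m.+1%:R * eps)%R (2 * q ^ 2)|)%N.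
Proof.
move=> K0 hm; set W := annular eps K q; set U := near_trivial _ _.
have [->|W0] := eqVneq W finset.set0; first by rewrite cards0 muln0.
have [th0 h0 pop] := annular_popular W0.
pose w th := #|annulus eps K th :&: annulus eps K th0|.
rewrite -(leq_pmul2l n_gt0).
(* A coordinate common to both annuli is within [eps + l eps] of [1] at the translate. *)
have far th (l : 'I_m) : th + th0 *+ l \notin U -> (2 * q ^ 2 * w th <= n)%N.
  rewrite inE -ltnNge => hU; apply: leq_trans (ltnW hU); rewrite leq_mul2l.
  apply/orP; right; apply: subset_leq_card; apply/fintype.subsetP => j.
  rewrite !inE => /andP[/andP[_ a1] /andP[_ a2]].
  apply: le_lt_trans (chdistD _ _ _) _; rewrite -natr1 mulrDl mul1r addrC.
  apply: ler_ltD a1; apply: le_trans (chdistMn _ _ _) _.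
  apply: ler_pM; rewrite ?ler0n ?chdist_ge0 ?ler_nat ?(ltW a2) //.
  exact: ltnW.
have tot : (2 * (m * (n * #|W|)) <=
    \sum_(l < m) \sum_(th in W) 2 * q ^ 2 * w th)%N.
  rewrite sum_nat_const card_ord mulnCA leq_mul2l; apply/orP; right.
  by rewrite -big_distrr /= -mulnA leq_mul2l pop orbT.
have split : (\sum_(l < m) \sum_(th in W) 2 * q ^ 2 * w th <=
    m * (n * #|W|) + \sum_(l < m) \sum_(th in W | (th + th0 *+ l)%R \in U) 2 * q ^ 2 * w th)%N.
  have -> : (m * (n * #|W|) = \sum_(l < m) n * #|W|)%N by rewrite sum_nat_const card_ord.
  rewrite -big_split /=.
  apply: leq_sum => l _.
  rewrite (bigID (fun th => (th + th0 *+ l)%R \in U)) /= addnC leq_add2r.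
  rewrite [leqRHS]mulnC -sum_nat_const big_mkcondr /=; apply: leq_sum => th _.
  by case: ifP => // hU; exact: far hU.
have main : (m * (n * #|W|) <=
    \sum_(l < m) \sum_(th in W | (th + th0 *+ l)%R \in U) 2 * q ^ 2 * w th)%N.
  have := leq_trans tot split; rewrite mul2n -addnn leq_add2l; exact.
rewrite mulnCA; apply: (leq_trans main).
have -> : (n * (8 * K * q ^ 2 * #|U|) = \sum_(eta in U) 2 * q ^ 2 * (n * (4 * K)))%N.
  rewrite sum_nat_const; ring.
(* Change of variables [eta = th + l th0], so that the sum over [l] can be taken first for fixed
   [eta]. *)
rewrite (eq_bigr (fun l : 'I_m => \sum_(eta in U | (eta - th0 *+ l)%R \in W)
    2 * q ^ 2 * w (eta - th0 *+ l)%R))%N; last first.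
  move=> l _; rewrite [LHS](reindex_inj (addIr (- (th0 *+ l)))) /=.
  by apply: eq_big => [eta|eta _]; rewrite ?subrK // andbC.
rewrite (eq_bigr (fun l : 'I_m => \sum_(eta in U)
    if (eta - th0 *+ l)%R \in W then 2 * q ^ 2 * w (eta - th0 *+ l)%R else 0))%N; last first.
  by move=> l _; rewrite big_mkcondr.
rewrite exchange_big /=; apply: leq_sum => eta _.
apply: (@leq_trans (\sum_(l < m) 2 * q ^ 2 * w (eta - th0 *+ l)%R)%N).
  by apply: leq_sum => l _; case: ifP.
rewrite -big_distrr /= leq_mul2l; apply/orP; right.
have wE th : w th = (\sum_(j in annulus eps K th0) (j \in annulus eps K th))%N.
  rewrite /w -sum1_card big_mkcond [RHS]big_mkcond /=; apply: eq_bigr => j _.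
  by rewrite finset.in_setI andbC; case: (j \in annulus eps K th0) => //=; case: (_ \in _).
under eq_bigr => l _ do rewrite wE.
rewrite exchange_big /=.
apply: (@leq_trans (\sum_(j in annulus eps K th0) 4 * K)%N).
  apply: leq_sum => j hj; apply: leq_trans (annulus_overlap eta K0 hm hj).
  rewrite -sum1_card [leqRHS]big_mkcond /=; apply: leq_sum => l _.
  by rewrite !inE; case: (_ <= _) => //=; case: (_ < _).
by rewrite sum_nat_const leq_mul2r -[leqRHS]card_ord max_card orbT.
Qed.

End SmallCharacters.

(** * Multiscale count of the light frequencies *)

Section LightSet.
Variable R : realType.
Local Notation C := (complex R).
Variables (G : finZmodType) (n : nat) (c : 'I_n -> G -> C) (p : nat).
Hypothesis cD : forall j th th', c j (th + th') = c j th * c j th'.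
Hypothesis c_unit : forall j th, cmod (c j th) = 1.
Hypothesis n_gt0 : (0 < n)%N.
Hypothesis far_from_1 : forall j th, th != 0 -> 1 <= p%:R * chdist c j th.

(** The estimate at radius [e] and fraction [1 / q] of the coordinates is of order [q^16 e]. With
    [q] doubling from one scale to the next, a ratio [2^17] between radii leaves a summable factor
    [2^-i]. *)
Let K := (2 ^ 17)%N.
Let scale (sig : R) i := sig / 2 ^+ (17 * i).
Let level a i := (2 ^ (a + i).+1)%N.

Definition light (a : nat) (sig : R) :=
  [set th | (n < 2 ^ a * #|[set j | (chdist c j th < sig)%R]|)%N].

Let scaleS sig i : scale sig i = K%:R * scale sig i.+1.
Proof.
rewrite /scale /K natrX mulnS exprD; field.
by rewrite !expf_neq0 // pnatr_eq0.
Qed.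

Lemma sum_half_lt k : \sum_(i < k) (2^-1 : R) ^+ i.+1 <= 1.
Proof.
have -> : \sum_(i < k) (2^-1 : R) ^+ i.+1 = 1 - 2^-1 ^+ k.
  elim: k => [|k IH]; first by rewrite big_ord0 expr0 subrr.
  by rewrite big_ord_recr /= IH !exprS; field.
by rewrite lerBlDr lerDl exprn_ge0 ?invr_ge0.
Qed.

(** No character gets closer to [1] than [1 / p], so [p] annuli cover all close coordinates. If
    annulus [i] always held fewer than [n / 2^(a+i+1)] of them, the total would be at most
    [n / 2^a]. *)
Lemma light_annular a sig th : 0 < sig -> sig <= 1 -> th != 0 ->
  th \in light a sig ->
  [exists i : 'I_p, th \in annular c (scale sig i) K (level a i)].
Proof.
move=> s0 s1 th0; rewrite inE => hth.
case: (boolP [exists i : 'I_p, _]) => // /existsPn hno; exfalso.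
move: hth; apply/negP; rewrite -leqNgt.
have near j : chdist c j th < sig ->
    exists i : 'I_p, j \in annulus c (scale sig i) K th.
  move=> hj; have p0 : (0 < p)%N.
    by rewrite lt0n; apply/eqP => p0; have := far_from_1 j th0; rewrite p0 mul0r ler10.
  have hp : scale sig p <= chdist c j th.
    rewrite /scale ler_pdivrMr ?exprn_gt0 //; apply: (le_trans s1).
    apply: le_trans (far_from_1 j th0) _; rewrite mulrC ler_wpM2l ?chdist_ge0 //.
    rewrite -natrX ler_nat; apply: ltnW; apply: leq_trans (ltn_expl p (isT : (1 < 2)%N)) _.
    by rewrite leq_exp2l // leq_pmull.
  have ex : exists i, scale sig i <= chdist c j th by exists p.
  case: (ex_minnP ex) => -[|i] hi imin.
    by move: hi; rewrite /scale muln0 expr0 divr1 leNgt hj.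
  have ip : (i < p)%N by exact: imin.
  exists (Ordinal ip); rewrite inE scaleS /= ler_wpM2l ?ler0n //= -scaleS.
  by rewrite ltNge; apply/negP => /imin; rewrite ltnn.
have cov : (#|[set j | (chdist c j th < sig)%R]| <=
    \sum_(i < p) #|annulus c (scale sig i) K th|)%N.
  have cardE (A : {set 'I_n}) : #|A| = (\sum_j (j \in A))%N.
    by rewrite -sum1_card big_mkcond; apply: eq_bigr => j _; case: (j \in A).
  under eq_bigr => i _ do rewrite cardE.
  rewrite cardE exchange_big; apply: leq_sum => j _.
  case: (boolP (j \in [set _ | _])) => //=; rewrite inE => /near[i hi].
  by rewrite (bigD1 i) //= hi.
rewrite -(ler_nat R); apply: (@le_trans _ _ (\sum_(i < p) n%:R * (2^-1 : R) ^+ i.+1)).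
  apply: (@le_trans _ _ ((2 ^ a * \sum_(i < p) #|annulus c (scale sig i) K th|)%N)%:R).
    by rewrite ler_nat leq_mul2l cov orbT.
  rewrite big_distrr /= natr_sum; apply: ler_sum => i _.
  have := hno i; rewrite inE -ltnNge /level => /ltnW; rewrite -(ler_nat R) => h.
  rewrite exprVn ler_pdivlMr ?exprn_gt0 // -natrX -natrM.
  by apply: le_trans h; rewrite ler_nat -addnS expnD mulnAC.
by rewrite -mulr_sumr ler_piMr ?ler0n ?sum_half_lt.
Qed.

(** [card_annular] is applied with [m] of order [1 / (q^2 e)], as large as the moment bound
    [card_near_trivial] allows at radius [(m + 1) e]; the gain [m] provides the factor [sig]. *)
Lemma card_annular_scale a (s : nat) (sig E : R) i :
    0 < sig -> 64 * 4 ^+ a.+1 * sig <= 1 -> ((16 * 4 ^ a.+1) ^ 2 <= p)%N ->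
    (s <= 4)%N -> 0 <= E ->
    (forall l l' : nat, (l < p)%N -> (l' < p)%N -> l != l' ->
       \sum_th cmod (charsum c (th *+ l - th *+ l')) ^+ s <= E) ->
  #|annular c (scale sig i) K (level a i)|%:R <=
    2 ^+ (51 + 16 * a.+1) * sig * (E / n%:R ^+ s) * 2^-1 ^+ i.
Proof.
move=> s0 sa pa s4 E0 hE.
have n0 : 0 < n%:R :> R by rewrite ltr0n.
have rhs0 : 0 <= 2 ^+ (51 + 16 * a.+1) * sig * (E / n%:R ^+ s) * 2^-1 ^+ i.
  apply: mulr_ge0; last by rewrite exprn_ge0 // invr_ge0 ler0n.
  apply: mulr_ge0; last by rewrite divr_ge0 // exprn_ge0 // ler0n.
  by apply: mulr_ge0; [rewrite exprn_ge0 // ler0n | exact: ltW].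
set e := scale sig i; set q := level a i; set W := annular _ _ _ _.
have [->|W0] := eqVneq W finset.set0; first by rewrite cards0.
have e0 : 0 < e by rewrite divr_gt0 ?exprn_gt0.
have q0 : (0 < q)%N by rewrite expn_gt0.
have s1 : sig <= 1.
  apply: le_trans sa; rewrite ler_peMl ?(ltW s0) //.
  have : 1 <= 4 ^+ a.+1 :> R by rewrite exprn_ege1 // ler1n.
  lra.
(* An annulus that is not empty has radius above [1 / p]. This keeps the multiples used below, fewer
   than [M], in the range [l < p] of the moment hypothesis. *)
have ip : (2 ^ (17 * i) <= p)%N.
  have /finset.set0Pn[th hth] := W0.
  move: hth; rewrite inE => hth.
  have /finset.set0Pn[j] : annulus c e K th != finset.set0.
    by apply/eqP => h; move: hth; rewrite h cards0 muln0 leqNgt n_gt0.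
  rewrite inE => /andP[h1 h2].
  have th0 : th != 0.
    apply/eqP => h; move: h1; rewrite h /chdist char0 // subrr.
    by rewrite ComplexField.Normc.normc0 mulr0 leNgt e0.
  have : 1 <= p%:R * e.
    by apply: le_trans (far_from_1 j th0) _; rewrite ler_wpM2l ?ler0n // ltW.
  rewrite /e /scale mulrA ler_pdivlMr ?exprn_gt0 // mul1r -(ler_nat R) natrX => h.
  by apply: (le_trans h); rewrite ler_piMr ?ler0n.
pose Q := (2 * q ^ 2)%N; pose M := (8 * Q)%N.
have Q0 : (0 < Q)%N by rewrite muln_gt0 expn_gt0 q0.
have qE : (q = 2 ^ a.+1 * 2 ^ i)%N by rewrite /q /level -expnD addSn.
have ME : (M = 16 * 4 ^ a.+1 * 4 ^ i)%N.
  rewrite /M /Q qE expnMn mulnA -!expnM ![(_ * 2)%N]mulnC !expnM mulnA; done.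
have Mp : (M <= p)%N.
  rewrite -leq_sqr ME expnMn -[leqRHS]mulnn leq_mul //.
  apply: leq_trans ip; rewrite -[4%N]/(2 ^ 2)%N -!expnM leq_exp2l //.
  by rewrite ?mulnA [(2 * i)%N]mulnC -mulnA mulnC leq_mul2r orbT.
have q0' : 0 < q%:R :> R by rewrite ltr0n.
(* Chosen so that [2 y e M = 1 / 2] with [M = 16 q^2]; then [m] is its integer part and
   [m + 1 <= 2 y]. *)
pose y : R := (64 * q%:R ^+ 2 * e)^-1.
have d0 : 0 < 64 * q%:R ^+ 2 * e by rewrite mulr_gt0 // mulr_gt0 ?exprn_gt0.
have qR : q%:R = 2 ^+ a.+1 * 2 ^+ i :> R by rewrite qE natrM !natrX.
clearbody q.
have q2e : q%:R ^+ 2 * e <= 4 ^+ a.+1 * sig.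
  have -> : 4 ^+ a.+1 = 2 ^+ (a.+1 * 2) :> R by rewrite mulnC exprM; congr (_ ^+ _); ring.
  have hB : (2 ^+ i) ^+ 2 <= 2 ^+ (17 * i) :> R.
    rewrite -exprM; apply: ler_weXn2l; first by rewrite ler1n.
    by rewrite mulnC leq_mul2r orbT.
  have D0 : 0 < 2 ^+ (17 * i) :> R by rewrite exprn_gt0.
  rewrite qR exprM /e /scale; set D := 2 ^+ (17 * i) in hB D0 *.
  set A := 2 ^+ a.+1; set B := 2 ^+ i in hB *.
  rewrite mulrA ler_pdivrMr // exprMn -mulrA [B ^+ 2 * _]mulrC mulrA.
  by rewrite ler_wpM2l // mulr_ge0 ?sqr_ge0 // ltW.
have y1 : 1 <= y.
  rewrite invf_ge1 //; apply: le_trans sa; rewrite -[64 * _ * e]mulrA -[64 * _ * sig]mulrA.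
  by apply: ler_wpM2l; rewrite ?ler0n.
have y0 : 0 <= y by apply: le_trans y1.
pose m := Num.truncn y.
have my : m%:R <= y by have := truncn_le y; rewrite y0.
have ym : y < m.+1%:R by exact: truncnS_gt.
have m0 : (0 < m)%N by rewrite truncn_gt0.
have m1 : 1 <= m%:R :> R by rewrite ler1n.
have ye : y * e = (64 * q%:R ^+ 2)^-1.
  by rewrite /y; field; rewrite !gt_eqF.
have q21 : 1 <= q%:R ^+ 2 :> R by rewrite exprn_ege1 // ler1n.
have me : m%:R * e <= 1 / 2.
  apply: (@le_trans _ _ (y * e)); first by rewrite ler_wpM2r // ltW.
  rewrite ye mul1r lef_pV2 ?posrE ?mulr_gt0 ?exprn_gt0 //; lra.
have h1 := card_annular cD c_unit n_gt0 q (K := K) isT me.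
have hrho : m.+1%:R * e * M%:R <= 1 / 2.
  apply: (@le_trans _ _ (2 * (y * e) * M%:R)).
    rewrite ler_wpM2r ?ler0n // mulrA ler_wpM2r ?(ltW e0) // -natr1; lra.
  rewrite ye /M /Q !natrM le_eqVlt; apply/orP; left; apply/eqP.
  by field; rewrite gt_eqF.
have h2 : #|near_trivial c (m.+1%:R * e) Q|%:R * (n%:R / M%:R) ^+ s <= M%:R ^+ 2 * E.
  apply: card_near_trivial => // l l' hl hl' hll.
  by apply: hE => //; apply: leq_trans Mp.
have cast (k w b d u : nat) : (k * w <= 8 * b * d ^ 2 * u)%N ->
    k%:R * w%:R <= 8 * b%:R * d%:R ^+ 2 * u%:R :> R.
  by rewrite -natrX -!natrM ler_nat.
have {}h1 := cast _ _ _ _ _ h1.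
rewrite -/W -/Q in h1; set U := near_trivial _ _ _ in h1 h2 *.
have M0 : 1 <= M%:R :> R by rewrite ler1n /M muln_gt0 Q0.
have Mn0 : M%:R != 0 :> R by rewrite gt_eqF //; apply: lt_le_trans M0.
have ns0 : 0 < n%:R ^+ s :> R by rewrite exprn_gt0.
have h3 : #|U|%:R <= M%:R ^+ 6 * (E / n%:R ^+ s).
  rewrite mulrA ler_pdivlMr //.
  apply: (@le_trans _ _ (M%:R ^+ s * (M%:R ^+ 2 * E))).
    apply: le_trans (ler_wpM2l _ h2); last by rewrite exprn_ge0 ?ler0n.
    rewrite expr_div_n le_eqVlt; apply/orP; left; apply/eqP; field.
    by rewrite expf_neq0.
  rewrite mulrA -exprD ler_wpM2r //; apply: ler_weXn2l => //.
  by rewrite addn2 !ltnS.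
have h4 : y * #|W|%:R <= 2 * (m%:R * #|W|%:R).
  by rewrite mulrA ler_wpM2r ?ler0n // ltW // (lt_le_trans ym) // -natr1; lra.
have h5 : y * #|W|%:R <= 2 * (8 * K%:R * q%:R ^+ 2 * (M%:R ^+ 6 * (E / n%:R ^+ s))).
  apply: (le_trans h4); rewrite ler_wpM2l ?ler0n //; apply: (le_trans h1).
  by rewrite ler_wpM2l // ?mulr_ge0 ?exprn_ge0 ?ler0n.
(* The constant is [2 * 8 * 2^17 * 16^6 * 64 = 2^51] and the power of [q] is [2 + 12 + 2]. *)
have h6 : #|W|%:R <= 2 ^+ 51 * (q%:R ^+ 16 * e) * (E / n%:R ^+ s).
  rewrite /y mulrC ler_pdivrMr // in h5; apply: (le_trans h5).
  rewrite le_eqVlt; apply/orP; left; apply/eqP.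
  rewrite /K [(2 ^ 17)%:R]natrX /M /Q !natrM; ring.
apply: (le_trans h6); rewrite le_eqVlt; apply/orP; left; apply/eqP.
have e17 : 2 ^+ (17 * i) = 2 ^+ (16 * i) * 2 ^+ i :> R by rewrite -exprD -mulSnr.
rewrite qR exprMn -!exprM /e /scale e17 exprD [(i * 16)%N]mulnC [(a.+1 * 16)%N]mulnC exprVn.
move: (2 ^+ 51 : R) (2 ^+ (16 * a.+1) : R) => x1 x2.
have x3 : 2 ^+ (16 * i) != 0 :> R by rewrite expf_neq0 // pnatr_eq0.
have x4 : 2 ^+ i != 0 :> R by rewrite expf_neq0 // pnatr_eq0.
move: x3 x4; set x3 := 2 ^+ (16 * i); set x4 := 2 ^+ i; set F := E / _ => h7 h8.
by field; rewrite h7 h8.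
Qed.

(** The summand [1] is the frequency [0]; the others are summed over the scales, at the cost of one
    more factor [2]. *)
Lemma card_light a (s : nat) (sig E : R) :
    0 < sig -> 64 * 4 ^+ a.+1 * sig <= 1 -> ((16 * 4 ^ a.+1) ^ 2 <= p)%N ->
    (s <= 4)%N -> 0 <= E ->
    (forall l l' : nat, (l < p)%N -> (l' < p)%N -> l != l' ->
       \sum_th cmod (charsum c (th *+ l - th *+ l')) ^+ s <= E) ->
  #|light a sig|%:R <= 1 + 2 ^+ (52 + 16 * a.+1) * sig * (E / n%:R ^+ s).
Proof.
move=> s0 sa pa s4 E0 hE.
have s1 : sig <= 1.
  apply: le_trans sa; rewrite ler_peMl ?(ltW s0) //.
  have : 1 <= 4 ^+ a.+1 :> R by rewrite exprn_ege1 // ler1n.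
  lra.
have cov : (#|light a sig| <=
    1 + \sum_(i < p) #|annular c (scale sig i) K (level a i)|)%N.
  have cardE (A : {set G}) : #|A| = (\sum_th (th \in A))%N.
    by rewrite -sum1_card big_mkcond; apply: eq_bigr => j _; case: (j \in A).
  under eq_bigr => i _ do rewrite cardE.
  rewrite cardE exchange_big (bigD1 0) //= [X in (_ <= _ + X)%N](bigD1 0) //=.
  rewrite addnA leq_add //; first by case: (0 \in _); rewrite // leq_addr.
  apply: leq_sum => th th0; case: (boolP (th \in light _ _)) => // hth.
  by have /existsP[i hi] := light_annular s0 s1 th0 hth; rewrite (bigD1 i) //= hi.
have n0 : 0 < n%:R ^+ s :> R by rewrite exprn_gt0 // ltr0n.
rewrite -(ler_nat R) natrD natr_sum in cov; apply: (le_trans cov).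
rewrite lerD2l; apply: (@le_trans _ _ (\sum_(i < p)
   2 ^+ (51 + 16 * a.+1) * sig * (E / n%:R ^+ s) * 2^-1 ^+ i)).
  by apply: ler_sum => i _; exact: card_annular_scale.
have hs : \sum_(i < p) (2^-1 : R) ^+ i <= 2.
  have := sum_half_lt p.
  under eq_bigr => i _ do rewrite exprS.
  by rewrite -mulr_sumr mulrC ler_pdivrMr // mul1r.
rewrite -mulr_sumr.
have -> : 2 ^+ (52 + 16 * a.+1) * sig * (E / n%:R ^+ s) =
   2 ^+ (51 + 16 * a.+1) * sig * (E / n%:R ^+ s) * 2.
  by rewrite !addSn add0n !exprS; ring.
apply: ler_wpM2l => //; apply: mulr_ge0; last by rewrite divr_ge0 // ltW.
by apply: mulr_ge0; [rewrite exprn_ge0 // ler0n | exact: ltW].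
Qed.

End LightSet.

(** * Additive characters of the prime field and their moments *)

Section PrimeFieldCharacter.
Variable R : realType.
Local Notation C := (complex R).
Variables (p : nat) (omega : C).
Hypothesis p_pr : prime p.
Hypothesis omegaX : omega ^+ p = 1.
Hypothesis omega1 : omega != 1.

Definition fpchar (x : 'F_p) : C := omega ^+ x.

Lemma cmod_omega : cmod omega = 1.
Proof.
apply/eqP; rewrite -(@pexpr_eq1 _ _ p) ?prime_gt0 ?cmod_ge0 //.
by rewrite -cmodX omegaX ComplexField.Normc.normc1.
Qed.

Lemma fpcharD x y : fpchar (x + y) = fpchar x * fpchar y.
Proof.
have omegaX' : omega ^+ (Zp_trunc (pdiv p)).+2 = 1 by rewrite Fp_cast.
by rewrite /fpchar -exprD /= (expr_mod _ omegaX').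
Qed.

Lemma cmod_fpchar x : cmod (fpchar x) = 1.
Proof. by rewrite cmodX cmod_omega expr1n. Qed.

Lemma fpchar_eq1 x : (fpchar x == 1) = (x == 0).
Proof.
have [m m_prim m_dvd] := prim_order_exists (prime_gt0 p_pr) omegaX.
have mp : m = p.
  move/primeP: (p_pr) => [_ /(_ m m_dvd)] /orP[] /eqP // m1.
  by move: (prim_expr_order m_prim); rewrite m1 expr1 => /eqP; rewrite (negPf omega1).
rewrite mp in m_prim; rewrite /fpchar -(prim_order_dvd m_prim).
apply/idP/eqP => [hd|->]; last by rewrite dvdn0.
apply: val_inj => /=; apply/eqP; move: hd; apply: contraLR; rewrite -lt0n => x0.
by rewrite gtnNdvd //; have := ltn_ord x; rewrite [X in (_ < X)%N]Fp_cast.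
Qed.

Lemma sum_fpchar x : \sum_(th : 'F_p) fpchar (th * x) = (p * (x == 0))%:R.
Proof.
have [->|x0] := eqVneq x 0.
  rewrite muln1 (eq_bigr (fun _ => 1)) ?sumr_const ?card_Fp //.
  by move=> th _; rewrite mulr0 /fpchar expr0.
rewrite muln0; set S := \sum_(_ | _) _.
have h : S = fpchar x * S.
  rewrite {1}/S (reindex_inj (addIr 1)) /= mulr_sumr; apply: eq_bigr => th _.
  by rewrite mulrDl mul1r fpcharD mulrC.
have : (1 - fpchar x) * S = 0 by rewrite mulrBl mul1r -h subrr.
by move/eqP; rewrite mulf_eq0 subr_eq0 eq_sym fpchar_eq1 (negPf x0) => /eqP.
Qed.

(* Otherwise all powers of [fpchar x] lie in the open unit disc around [1],
   although they sum to [0]. *)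
Lemma fpchar_far x : x != 0 -> 1 <= p%:R * cmod (1 - fpchar x).
Proof.
move=> x0; have p0 := prime_gt0 p_pr.
have zp : fpchar x ^+ p = 1 by rewrite /fpchar -exprM mulnC exprM omegaX expr1n.
have s0 : \sum_(l < p) fpchar x ^+ l = 0.
  have : (fpchar x - 1) * \sum_(l < p) fpchar x ^+ l = 0 by rewrite -subrX1 zp subrr.
  by move/eqP; rewrite mulf_eq0 subr_eq0 fpchar_eq1 (negPf x0) => /eqP.
rewrite leNgt; apply/negP => hlt.
have : (p%:R : R) <= \sum_(l < p) (p%:R * cmod (1 - fpchar x)).
  rewrite -[leLHS](cmod_nat R p) -[p%:R]subr0 -{1}s0 -{1}[p]card_ord -sumr_const -sumrB.
  apply: le_trans (cmod_sum _ _ _) _; apply: ler_sum => l _.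
  apply: le_trans (cmod1B_exp _ (cmod_fpchar x)) _.
  by rewrite ler_wpM2r ?cmod_ge0 // ler_nat ltnW.
by rewrite sumr_const card_ord leNgt -[ltLHS]mulr_natr gtr_pMl ?ltr0n // hlt.
Qed.

Definition dilate (D : 'F_p) (th : 'F_p) : C := fpchar (th * D).

Lemma dilateD D th th' : dilate D (th + th') = dilate D th * dilate D th'.
Proof. by rewrite /dilate mulrDl fpcharD. Qed.

Lemma fpchar_conj x : (fpchar x)^*%C = fpchar (- x).
Proof.
rewrite -[LHS]mulr1 -[X in _ * X](_ : fpchar (x + - x) = 1); last first.
  by apply/eqP; rewrite fpchar_eq1 subrr.
rewrite fpcharD mulrA [_^*%C * _]mulrC -sqr_normc -add_Re2_Im2 -/(csqr _).
by rewrite csqrE cmod_fpchar expr1n mul1r.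
Qed.

Variables (n : nat) (D : 'I_n -> 'F_p).

(** Multiplication by the nonzero residue [l - l'] permutes the frequencies, so one moment bound
    serves all pairs of multiples. *)
Lemma sum_dilate (l l' : nat) (F : 'F_p -> R) : (l < p)%N -> (l' < p)%N -> l != l' ->
  \sum_th F (th *+ l - th *+ l') = \sum_th F th.
Proof.
move=> hl hl' hll.
have e0 : (l%:R - l'%:R : 'F_p) != 0.
  rewrite subr_eq0; apply: contra hll => /eqP/(congr1 val) /=.
  by rewrite !val_Fp_nat // !modn_small // => ->.
rewrite [RHS](reindex_inj (mulIf e0)); apply: eq_bigr => th _.
by rewrite mulrBr !mulr_natr.
Qed.

Lemma csqrCE (z : C) : (csqr z)%:C%C = z * z^*%C.
Proof. by rewrite -sqr_normc -add_Re2_Im2. Qed.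

Lemma csqr_sum_fpchar (I : finType) (f : I -> 'F_p) :
  (csqr (\sum_i fpchar (f i)))%:C%C = \sum_(q : I * I) fpchar (f q.1 - f q.2).
Proof.
rewrite csqrCE rmorph_sum mulr_suml -(pair_big xpredT xpredT (fun i j => fpchar (f i - f j))).
apply: eq_bigr => i _; rewrite mulr_sumr; apply: eq_bigr => j _.
by rewrite /= fpchar_conj -fpcharD.
Qed.

(** Expand the square and apply orthogonality: only pairs with equal [D] survive. *)
Lemma moment2 (E : nat) :
    (#|[set q : 'I_n * 'I_n | D q.1 == D q.2]| <= E)%N ->
  \sum_th cmod (charsum (fun j => dilate (D j)) th) ^+ 2 <= (p * E)%:R.
Proof.
move=> hE; apply: (@le_trans _ _ (p * #|[set q : 'I_n * 'I_n | D q.1 == D q.2]|)%:R); last first.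
  by rewrite ler_nat leq_mul2l hE orbT.
rewrite le_eqVlt; apply/orP; left; apply/eqP/(@complexI R).
rewrite rmorph_sum /= rmorph_nat.
under eq_bigr => th _.
  rewrite -csqrE csqr_sum_fpchar; over.
rewrite exchange_big /=; under eq_bigr => q _.
  under eq_bigr => th _ do rewrite -mulrBr.
  rewrite sum_fpchar subr_eq0; over.
rewrite -natr_sum -big_distrr /= -sum1_card [X in (_ * X)%N]big_mkcond [in RHS]big_mkcond /=.
by congr (_ * _)%:R; apply: eq_bigr => q _; rewrite inE; case: (_ == _).
Qed.

(** The same for the square of the character sum, which is itself a sum of characters indexed by
    pairs. *)
Lemma moment4 (E : nat) :
    (#|[set q : ('I_n * 'I_n) * ('I_n * 'I_n) |
        (D q.1.1 + D q.1.2 == D q.2.1 + D q.2.2)%R]| <= E)%N ->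
  \sum_th cmod (charsum (fun j => dilate (D j)) th) ^+ 4 <= (p * E)%:R.
Proof.
set S := [set _ | _] => hE; apply: (@le_trans _ _ (p * #|S|)%:R); last first.
  by rewrite ler_nat leq_mul2l hE orbT.
rewrite le_eqVlt; apply/orP; left; apply/eqP/(@complexI R).
rewrite rmorph_sum /= rmorph_nat.
have sq th : charsum (fun j => dilate (D j)) th ^+ 2 =
    \sum_(q : 'I_n * 'I_n) fpchar (th * (D q.1 + D q.2)).
  rewrite expr2 /charsum mulr_suml.
  under eq_bigr => j _ do (rewrite mulr_sumr;
    under eq_bigr => j' _ do rewrite /dilate -fpcharD -mulrDr).
  by rewrite pair_big.
under eq_bigr => th _.
  rewrite (exprM _ 2 2) -cmodX -csqrE sq csqr_sum_fpchar; over.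
rewrite exchange_big /=; under eq_bigr => q _.
  under eq_bigr => th _ do rewrite -mulrBr.
  rewrite sum_fpchar subr_eq0; over.
rewrite -natr_sum -big_distrr /= -sum1_card [X in (_ * X)%N]big_mkcond [in RHS]big_mkcond /=.
by congr (_ * _)%:R; apply: eq_bigr => q _; rewrite /S inE; case: (D q.1.1 + D q.1.2 == _).
Qed.

End PrimeFieldCharacter.

(** Any root of [1 + X + ... + X^(p-1)] works, since this polynomial takes the value [p] at [1]. *)
Lemma exists_root_of_unity (R : realType) (p : nat) : prime p ->
  exists omega : complex R, omega ^+ p = 1 /\ omega != 1.
Proof.
move=> p_pr; pose P : {poly complex R} := \poly_(i < p) 1.
have sP : size P = p by rewrite size_poly_eq ?oner_eq0.
have [w /rootP hw] : exists w, root P w.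
  by apply/closed_rootP; rewrite sP; apply/eqP => h; rewrite h in p_pr.
have sw : \sum_(i < p) w ^+ i = 0.
  by move: hw; rewrite horner_poly => hw; rewrite -[RHS]hw; apply: eq_bigr => i _; rewrite mul1r.
exists w; split.
  by apply/eqP; rewrite -subr_eq0 subrX1 sw mulr0.
apply/eqP => w1; move: sw; rewrite w1 (eq_bigr (fun _ => 1)) => [|i _]; last by rewrite expr1n.
by rewrite sumr_const card_ord => /eqP; rewrite pnatr_eq0 -leqn0 leqNgt prime_gt0.
Qed.

(** * Sign vectors and directions as bit strings *)

Section CubeEncoding.
Variable n : nat.
Implicit Types (u v x y : 'rV[int]_n) (s : seq bool) (B : {fset 'rV[int]_n}).

Definition sign_row s : 'rV[int]_n := \row_j (if nth false s j then 1 else -1).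

Definition cube_row u v s : 'rV[int]_n :=
  \row_j (if nth false s j then u 0 j else v 0 j).

Definition sign_pred B : seq bool -> bool := fun s => sign_row s \in B.

Definition sign_bits y : n.-tuple bool := [tuple y 0 i == 1 | i < n].

Lemma sign_rowK B y : sign_vectors B -> y \in B -> sign_row (sign_bits y) = y.
Proof.
move=> sB yB; apply/rowP => j; rewrite mxE.
rewrite -tnth_nth tnth_mktuple.
by case: (sB y yB j) => ->.
Qed.

Lemma sign_row_inj (t t' : n.-tuple bool) : sign_row t = sign_row t' -> t = t'.
Proof.
move/rowP => h; apply: eq_from_tnth => j; have := h j; rewrite !mxE -!tnth_nth.
by case: (tnth t j); case: (tnth t' j).
Qed.

Lemma card_sign_filter B (P : pred 'rV[int]_n) : sign_vectors B ->
  #|` [fset y in B | P y]%fset| =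
  #|[set t : n.-tuple bool | sign_pred B t && P (sign_row t)]|.
Proof.
move=> sB; set T := [set _ | _].
have -> : [fset y in B | P y]%fset = [fset sign_row (val t) | t in T]%fset.
  apply/fsetP => y; rewrite !inE; apply/andP/imfsetP => [[yB Py]|[t]] /=.
    by exists (sign_bits y); rewrite ?inE /sign_pred (sign_rowK sB yB) // yB.
  by rewrite inE => /andP[h1 h2] ->.
rewrite card_imfset /=; last by move=> t t' /sign_row_inj.
by rewrite -cardE.
Qed.

Lemma tcard_sign_pred (R : rcfType) B : sign_vectors B ->
  tcard R n (sign_pred B) = #|` B|%:R.
Proof.
move=> sB.
have -> : #|` B| = #|[set t : n.-tuple bool | sign_pred B t]|.
  transitivity #|` [fset y in B | xpredT y]%fset|.
    by congr #|` _|; apply/fsetP => y; rewrite !inE andbT.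
  by rewrite card_sign_filter //; apply: eq_card => t; rewrite !inE andbT.
rewrite /tcard cubesum_tuple -natr_sum -sum1_card [in RHS]big_mkcond /=.
by congr (_%:R); apply: eq_bigr => t _; rewrite inE; case: (sign_pred _ _).
Qed.

End CubeEncoding.

(** * Point counts in terms of exponential sums *)

Section Glue.
Variable R : realType.
Local Notation C := (complex R).
Variables (p : nat) (omega : C).
Hypothesis p_pr : prime p.
Hypothesis omegaX : omega ^+ p = 1.
Hypothesis omega1 : omega != 1.
Local Notation chi := (@fpchar R p omega).

Lemma expsum_prod (cs : seq (C * C)) B s :
  expsum cs B s = cubesum (size cs) (fun t => (B t)%:R *
    \prod_(0 <= i < size cs)
      (let z := sel (nth (1, 1) cs i) (nth false s i) in
       if nth false t i then z else z^-1)).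
Proof.
elim: cs B s => [|c cs IH] B s /=; first by rewrite big_nil mulr1.
rewrite !IH -!cubesumZ; congr (_ + _); apply: eq_cubesum => t.
all: rewrite big_nat_recl //= nth0 mulrCA; congr (_ * _).
all: by congr (_ * _); apply: eq_bigr => i _; rewrite nth_behead.
Qed.

Variables (n : nat) (u v : 'rV[int]_n) (B : {fset 'rV[int]_n}).
Hypothesis sB : sign_vectors B.

Definition branches (th : 'F_p) : seq (C * C) :=
  [seq (chi (th * (u 0 j)%:~R), chi (th * (v 0 j)%:~R)) | j <- enum 'I_n].

Lemma size_branches th : size (branches th) = n.
Proof. by rewrite size_map size_enum_ord. Qed.

Lemma fpchar0 : chi 0 = 1.
Proof. by rewrite /fpchar expr0. Qed.

Lemma fpcharN x : chi (- x) = (chi x)^-1.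
Proof.
have h : chi x * chi (- x) = 1 by rewrite -fpcharD // subrr fpchar0.
have x0 : chi x != 0 by apply/eqP => h0; move: h; rewrite h0 mul0r => /eqP; rewrite eq_sym oner_eq0.
by apply: (mulfI x0); rewrite h divff.
Qed.

Lemma expsum_branches th s :
  expsum (branches th) (sign_pred B) s =
  \sum_(t : n.-tuple bool) (sign_pred B t)%:R *
     chi (th * (dotz (cube_row u v s) (sign_row n t))%:~R).
Proof.
rewrite expsum_prod size_branches cubesum_tuple; apply: eq_bigr => t _.
congr (_ * _); rewrite big_mkord /dotz rmorph_sum mulr_sumr.
rewrite (big_morph chi (fpcharD p_pr omegaX) fpchar0); apply: eq_bigr => j _ /=.
rewrite !mxE (nth_map j) ?size_enum_ord // nth_ord_enum intrM.
case: (nth false t j); rewrite ?mulr1 /sel.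
  by case: (nth false s j).
by rewrite mulrN1z mulrN mulr1 mulrN fpcharN; case: (nth false s j).
Qed.

(** Fourier inversion modulo [p], then the triangle inequality. Only an inequality is needed, as
    [<x, y> = k] implies the congruence. *)
Lemma count_le_expsum s k :
  (p * #|` [fset y in B | dotz (cube_row u v s) y == k]%fset|)%:R <=
    \sum_th cmod (expsum (branches th) (sign_pred B) s).
Proof.
apply: (@le_trans _ _ (cmod (\sum_th chi (- (th * k%:~R)) *
  expsum (branches th) (sign_pred B) s))); last first.
  apply: le_trans (cmod_sum _ _ _) _; apply: ler_sum => th _.
  by rewrite ComplexField.Normc.normcM cmod_fpchar // mul1r.
under eq_bigr => th _ do rewrite expsum_branches mulr_sumr.
rewrite exchange_big /=.
have -> : \sum_(t : n.-tuple bool) \sum_th chi (- (th * k%:~R)) *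
    ((sign_pred B t)%:R * chi (th * (dotz (cube_row u v s) (sign_row n t))%:~R))
  = (\sum_(t : n.-tuple bool) sign_pred B t * (p *
      ((dotz (cube_row u v s) (sign_row n t))%:~R == k%:~R :> 'F_p)))%:R.
  rewrite natr_sum; apply: eq_bigr => t _; rewrite natrM.
  rewrite -subr_eq0 -(sum_fpchar p_pr omegaX omega1) mulr_sumr.
  by apply: eq_bigr => th _; rewrite mulrCA -fpcharD // addrC mulrBr.
rewrite cmod_nat ler_nat card_sign_filter // -sum1_card big_distrr /= big_mkcond /=.
apply: leq_sum => t _; rewrite inE; case: (sign_pred B t) => //=.
case: (_ =P k) => // ->; by rewrite eqxx !muln1 mul1n.
Qed.

Lemma branches_unimodular th : unimodular (branches th).
Proof. by move=> c /mapP[j _ ->]; rewrite /= !cmod_fpchar. Qed.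

Definition twice_diff (j : 'I_n) : 'F_p := (2 * cube_diff u v j)%:~R.

Lemma count_light_branches sig th :
  count (predC (heavy sig)) (branches th) =
  #|[set j | chdist (fun j => dilate omega (twice_diff j)) j th < sig]|.
Proof.
rewrite cardE /branches count_map -size_filter /enum_mem; congr size.
rewrite -filter_predI; apply: eq_filter => j; rewrite !inE /= andbT /heavy -ltNge.
congr (_ < _); rewrite /gap /chdist /dilate /twice_diff /cube_diff /=.
set a := th * _; set b := th * _.
have -> : th * (2 * (u 0 j - v 0 j))%:~R = (a + a) - (b + b).
  by rewrite /a /b intrM intrB; ring.
rewrite -[RHS]mul1r -(cmod_fpchar p_pr omegaX (b + b)) -ComplexField.Normc.normcM.
rewrite mulrBr mulr1 -fpcharD // [b + b + _]addrC subrK -normcN opprB !fpcharD // -!expr2.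
Qed.

End Glue.

(** * Averaging over frequencies and directions *)

Section AverageBound.
Variable R : realType.
Local Notation C := (complex R).
Variables (p : nat) (omega : C).
Hypothesis p_pr : prime p.
Hypothesis omegaX : omega ^+ p = 1.
Hypothesis omega1 : omega != 1.
Variables (n : nat) (u v : 'rV[int]_n) (B : {fset 'rV[int]_n}).
Hypothesis sB : sign_vectors B.
Hypothesis B_gt0 : (0 < #|` B|)%N.
Variables (h t sig rho : R) (a G : nat).
Hypothesis h1 : 1 < h.
Hypotheses (t0 : 0 < t) (t1 : t <= 1) (ht : 1 + t <= h).
Hypothesis tG : t ^- G <= h ^+ n.
Hypothesis ha : 2 <= h ^+ (2 ^ a).
Hypotheses (sig0 : 0 <= sig) (rho0 : 0 < rho) (rho1 : rho <= 1).
Hypothesis hrho : 1 - (h - 1) ^+ 2 * sig ^+ 2 / 8 <= rho.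

(** All losses are measured in powers of [h]: this choice gives [1 + sqrt lam = h], and the
    threshold [X] below makes the spread term at most [|B| h^-n] while costing the tilted term only
    [h^(2 n)]. *)
Let lam := (h - 1) ^+ 2.
Let bs : R := #|` B|%:R.
Let V := light (fun j => dilate omega (twice_diff p u v j)) a sig.
Let br (th : 'F_p) := branches omega u v th.
Let X := Num.sqrt bs / h ^+ (2 * n).
Let tilted th s := X^-1 * (t ^- G * wsum lam sig (tilt t) (br th) (sign_pred B) s).
Let avg s := (\sum_(th | th \notin V) tilted th s) / (p%:R * bs).

Let h0 : 0 < h. Proof. by apply: lt_trans h1. Qed.
Let lam0 : 0 < lam. Proof. by rewrite exprn_gt0 // subr_gt0. Qed.
Let sqrt_lam : Num.sqrt lam = h - 1.
Proof. by rewrite sqrtr_sqr ger0_norm // subr_ge0 ltW. Qed.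
Let bs0 : 0 < bs. Proof. by rewrite ltr0n. Qed.
Let p0 : 0 < p%:R :> R. Proof. by rewrite ltr0n prime_gt0. Qed.
Let X0 : 0 < X. Proof. by rewrite divr_gt0 ?exprn_gt0 ?sqrtr_gt0. Qed.
Let t2 : 0 <= 2 * (1 + t).
Proof. by apply: mulr_ge0 => //; rewrite addr_ge0 // ltW. Qed.
Let tcardB : tcard R n (sign_pred B) = bs.
Proof. exact: tcard_sign_pred. Qed.
Let unim th : unimodular (br th).
Proof. exact: branches_unimodular. Qed.

Let tilted_ge0 th s : 0 <= tilted th s.
Proof.
apply: mulr_ge0; first by rewrite invr_ge0 ltW.
apply: mulr_ge0; first by rewrite invr_ge0 exprn_ge0 // ltW.
apply: wsum_ge0 => b b'; rewrite /tilt; apply: mulr_ge0.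
  by case: b; rewrite ?sqrtr_ge0.
by case: b' => //; exact: ltW.
Qed.

(** The exponent [6 n] collects [2 n] from [X], [n] from [t^-G], [2 n] from [1 + t <= h] and
    [1 + sqrt lam = h], and [n] from the at most [n / 2^a] light coordinates. *)
Let sum_tilted th : th \notin V ->
  \sum_(s : n.-tuple bool) tilted th s <= 2 ^+ n * h ^+ (6 * n).
Proof.
move=> hV; rewrite -!mulr_sumr -cubesum_tuple.
have := cubesum_tilt_le sig (sign_pred B) (ltW lam0) (ltW t0) t1 (@unim th).
rewrite size_branches tcardB sqrt_lam /br count_light_branches // => hc.
have hX : X^-1 * Num.sqrt bs = h ^+ (2 * n).
  by rewrite /X invf_div divfK // gt_eqF // sqrtr_gt0.
set N := #|_| in hc.
have hN : (2 ^ a * N <= n)%N.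
  by move: hV; rewrite /V inE -leqNgt.
have h2N : 2 ^+ N <= h ^+ n.
  apply: (@le_trans _ _ ((h ^+ (2 ^ a)) ^+ N)); first by rewrite lerXn2r ?nnegrE ?exprn_ge0 ?ler0n ?(ltW h0).
  by rewrite -exprM ler_weXn2l // ltW.
have hk : (2 * (1 + t) * (1 + (h - 1))) ^+ n <= 2 ^+ n * h ^+ (2 * n).
  rewrite [(1 + (h - 1))]addrC subrK exprM -exprMn lerXn2r ?nnegrE //.
  - by apply: mulr_ge0 => //; exact: ltW.
  - by apply: mulr_ge0; [exact: ler0n | rewrite exprn_ge0 ?(ltW h0)].
  by rewrite expr2 mulrA ler_wpM2r ?(ltW h0) // ler_wpM2l.
apply: (@le_trans _ _ (X^-1 * (h ^+ n * (Num.sqrt bs * (2 ^+ n * h ^+ (2 * n)) * h ^+ n)))).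
  rewrite ler_wpM2l ?invr_ge0 ?(ltW X0) //.
  apply: ler_pM => //.
  - by rewrite invr_ge0 exprn_ge0 // ltW.
  - rewrite cubesum_tuple; apply: sumr_ge0 => s _; apply: wsum_ge0 => b b'.
    rewrite /tilt; apply: mulr_ge0; first by case: b; rewrite ?sqrtr_ge0.
    by case: b' => //; exact: ltW.
  apply: (le_trans hc); apply: ler_pM => //; rewrite ?exprn_ge0 //.
    apply: mulr_ge0; first exact: sqrtr_ge0.
    apply: exprn_ge0; rewrite [1 + (h - 1)]addrC subrK; by apply: mulr_ge0 => //; exact: ltW.
  by rewrite ler_wpM2l ?sqrtr_ge0.
rewrite le_eqVlt; apply/orP; left; apply/eqP.
transitivity ((X^-1 * Num.sqrt bs) * (2 ^+ n * h ^+ (2 * n) * h ^+ n * h ^+ n)); first by ring.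
rewrite hX -!mulrA -!exprD mulrCA -exprD; congr (_ * _ ^+ _).
by rewrite !mulSn; ring.
Qed.

Definition bad_directions := [set s : n.-tuple bool | (h ^- n < avg s)%R].

(** Markov's inequality over the directions; the threshold [h^-n] adds one [n] to the exponent
    [6 n]. *)
Lemma card_bad_directions : #|bad_directions|%:R <= 2 ^+ n * h ^+ (7 * n) / bs.
Proof.
have hn : 0 < h ^- n by rewrite invr_gt0 exprn_gt0.
have markov : #|bad_directions|%:R * h ^- n <= \sum_(s : n.-tuple bool) avg s.
  rewrite mulr_natl -sumr_const big_mkcond /=; apply: ler_sum => s _.
  case: ifP => [|_]; first by rewrite inE => /ltW.
  rewrite divr_ge0 ?mulr_ge0 ?(ltW p0) ?(ltW bs0) //.
  by apply: sumr_ge0.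
have tot : \sum_(s : n.-tuple bool) avg s <= 2 ^+ n * h ^+ (6 * n) / bs.
  rewrite -mulr_suml exchange_big /= invfM mulrA ler_wpM2r ?invr_ge0 ?(ltW bs0) //.
  rewrite ler_pdivrMr //.
  apply: (@le_trans _ _ (\sum_(th | th \notin V) 2 ^+ n * h ^+ (6 * n))).
    by apply: ler_sum => th hV; exact: sum_tilted.
  rewrite sumr_const -[leLHS]mulr_natr ler_wpM2l ?mulr_ge0 ?exprn_ge0 ?(ltW h0) ?ler0n //.
  by rewrite ler_nat; apply: leq_trans (max_card _) _; rewrite card_Fp.
have := le_trans markov tot; rewrite ler_pdivrMr ?exprn_gt0 // => hh.
apply: (le_trans hh); rewrite le_eqVlt; apply/orP; left; apply/eqP.
by rewrite -[7%N]/(6 + 1)%N mulnDl mul1n exprD mulrA mulrAC.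
Qed.

(** Light frequencies are bounded trivially, the others through their energy. One [h^-n] comes from
    the spread term, the other from the average of the tilted terms. *)
Lemma prob_dot_le (s : n.-tuple bool) k tau : 0 < tau -> s \notin bad_directions ->
  prob_dot R B (cube_row u v s) k <=
    #|V|%:R / p%:R + (rho ^+ G + 2 * h ^- n) / tau + tau.
Proof.
move=> tau0; rewrite inE -leNgt => hs.
have hn : 0 < h ^- n by rewrite invr_gt0 exprn_gt0.
set es := fun th => expsum (br th) (sign_pred B) s.
have en th : csqr (es th) <= bs * wsum lam sig (decay rho) (br th) (sign_pred B) s.
  have := csqr_expsum_le (sign_pred B) s lam0 sig0 (ltW rho0) hrho (@unim th).
  by rewrite size_branches tcardB.
have triv th : cmod (es th) <= bs.
  rewrite -(@ler_pXn2r _ 2) ?nnegrE ?cmod_ge0 ?(ltW bs0) //.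
  rewrite -csqrE; apply: (le_trans (en th)); rewrite expr2 ler_wpM2l ?(ltW bs0) //.
  have := wsum_decay_le lam sig (br th) (sign_pred B) s (ltW rho0) rho1.
  by rewrite size_branches tcardB.
(* Linearises the square root: [|z|^2 <= b W] gives [|z| <= W / tau + b tau], so the tilted terms
   enter linearly and can be averaged. *)
have nontriv th : cmod (es th) <= (bs * rho ^+ G + bs * h ^- n + tilted th s) / tau + bs * tau.
  have sp := wsum_decay_split lam sig (br th) (sign_pred B) s G rho0 rho1 t0 t1 X0.
  rewrite size_branches tcardB in sp.
  have hq : X * wsum lam sig (@spread R) (br th) (sign_pred B) s <= bs * h ^- n.
    have := wsum_spread_le sig (br th) (sign_pred B) s (ltW lam0).
    rewrite size_branches tcardB sqrt_lam [1 + _]addrC subrK => hq.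
    apply: le_trans (ler_wpM2l (ltW X0) hq) _.
    rewrite /X le_eqVlt; apply/orP; left; apply/eqP.
    have e : bs = Num.sqrt bs * Num.sqrt bs by rewrite -expr2 sqr_sqrtr // ltW.
    rewrite [in RHS]e mul2n -addnn exprD; field.
    by rewrite expf_neq0 // gt_eqF.
  have ew : csqr (es th) <= bs * (bs * rho ^+ G + bs * h ^- n + tilted th s).
    apply: (le_trans (en th)); rewrite ler_wpM2l ?(ltW bs0) //.
    apply: (le_trans sp); rewrite /tilted lerD2r [bs * rho ^+ G]mulrC lerD2l //.
  have c0 := cmod_ge0 (es th); rewrite csqrE in ew.
  set W := bs * rho ^+ G + _ + _ in ew *.
  have W0 : 0 <= W.
    by rewrite -(pmulr_rge0 _ bs0); apply: le_trans ew; rewrite sqr_ge0.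
  have [hc|hc] := lerP (cmod (es th)) (bs * tau).
    by apply: ler_wpDl => //; rewrite divr_ge0 // ltW.
  apply: ler_wpDr; first by rewrite mulr_ge0 ?ltW.
  rewrite ler_pdivlMr // -(ler_pM2l bs0); apply: le_trans ew.
  by rewrite expr2 mulrCA ler_wpM2l // ltW.
have cnt := count_le_expsum p_pr omegaX omega1 u v sB s k.
rewrite natrM in cnt.
rewrite /prob_dot -/bs ler_pdivrMr // -(ler_pM2l p0); apply: (le_trans cnt).
rewrite -/br -/es (bigID (mem V)) /=.
apply: (@le_trans _ _ (#|V|%:R * bs + (\sum_(th | th \notin V)
  ((bs * rho ^+ G + bs * h ^- n) / tau + bs * tau + tilted th s / tau)))).
  apply: lerD.
    by rewrite mulr_natl -sumr_const; apply: ler_sum => th _; exact: triv.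
  by apply: ler_sum => th _; apply: le_trans (nontriv th) _; rewrite [leRHS]addrAC -[in leRHS]mulrDl.
set c1 := (bs * rho ^+ G + bs * h ^- n) / tau + bs * tau.
have c10 : 0 <= c1.
  by rewrite addr_ge0 ?divr_ge0 ?mulr_ge0 ?addr_ge0 ?mulr_ge0 ?exprn_ge0 // ltW.
have s1 : \sum_(th | th \notin V) (c1 + tilted th s / tau) <=
    p%:R * c1 + p%:R * bs * h ^- n / tau.
  rewrite big_split /= lerD //.
    rewrite sumr_const -[leLHS]mulr_natl ler_wpM2r // ler_nat.
    by apply: leq_trans (max_card _) _; rewrite card_Fp.
  rewrite -mulr_suml ler_wpM2r ?invr_ge0 ?(ltW tau0) //.
  by move: hs; rewrite /avg ler_pdivrMr ?mulr_gt0 // mulrC.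
apply: (@le_trans _ _ (#|V|%:R * bs + (p%:R * c1 + p%:R * bs * h ^- n / tau))).
  by rewrite lerD2l.
rewrite le_eqVlt; apply/orP; left; apply/eqP; rewrite /c1; field.
by rewrite !gt_eqF // exprn_gt0.
Qed.

End AverageBound.

(** * Elementary growth estimates *)

Section Growth.
Variable R : realType.

Lemma bernoulli_ge (e : R) n : 0 <= e -> 1 + n%:R * e <= (1 + e) ^+ n.
Proof.
move=> e0; elim: n => [|n IH]; first by rewrite mul0r addr0 expr0.
rewrite exprS; apply: (@le_trans _ _ ((1 + e) * (1 + n%:R * e))).
  rewrite -natr1; have : 0 <= n%:R * e * e by rewrite !mulr_ge0 ?ler0n.
  lra.
by rewrite ler_wpM2l // addr_ge0.
Qed.

Lemma exists_expr_ge (h x : R) : 1 < h -> exists N : nat, x <= h ^+ N.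
Proof.
move=> h1; have e0 : 0 < h - 1 by rewrite subr_gt0.
exists (Num.truncn (x / (h - 1))).+1.
rewrite [X in X ^+ _](_ : h = 1 + (h - 1)); last by ring.
apply: le_trans (bernoulli_ge _ (ltW e0)); apply: ler_wpDl => //.
by rewrite -ler_pdivrMr // ltW // truncnS_gt.
Qed.

(** Apply Bernoulli to [w = 1 + e], the tenth root of [h]: then [h^n >= (n e)^10 = n^5 (n e^2)^5],
    and [n e^2 >= 1] for large [n]. *)
Lemma poly5_le_expr (h : R) : 1 < h ->
  exists n0 : nat, forall n, (n0 <= n)%N -> n%:R ^+ 5 <= h ^+ n.
Proof.
move=> h1; pose w := h `^ 10^-1.
have h0 : 0 <= h by apply: ltW; apply: lt_trans h1.
have w10 : w ^+ 10 = h.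
  by rewrite -powR_mulrn ?powR_ge0 // -powRrM mulVf ?powRr1 ?pnatr_eq0.
have w1 : 1 < w.
  rewrite ltNge; apply/negP => hw; move: h1; rewrite -w10 ltNge => /negP[].
  by rewrite exprn_ile1 // powR_ge0.
pose e := w - 1; have e0 : 0 < e by rewrite subr_gt0.
exists (Num.truncn (e ^+ 2)^-1).+1 => n hn.
have ne : 1 <= n%:R * e ^+ 2.
  rewrite -ler_pdivrMr ?exprn_gt0 // div1r; apply: ltW.
  by apply: lt_le_trans (truncnS_gt _) _; rewrite ler_nat.
have wn : n%:R * e <= w ^+ n.
  have -> : w = 1 + e by rewrite /e; ring.
  by apply: le_trans (bernoulli_ge n (ltW e0)); rewrite lerDr.
rewrite -w10 -exprM mulnC exprM.
apply: (@le_trans _ _ ((n%:R * e) ^+ 10)); last first.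
  by rewrite lerXn2r ?nnegrE ?mulr_ge0 ?ler0n ?exprn_ge0 ?powR_ge0 // ltW.
have -> : (n%:R * e) ^+ 10 = n%:R ^+ 5 * (n%:R * e ^+ 2) ^+ 5 by ring.
by rewrite ler_peMr ?exprn_ge0 ?ler0n // exprn_ege1.
Qed.

Lemma ln_div_small (c : R) : 0 < c ->
  exists n0 : nat, forall n, (n0 <= n)%N -> (0 < n)%N -> ln n%:R / n%:R <= c.
Proof.
move=> c0; have [|n0 hn0] := @poly5_le_expr (sequences.expR (5 * c)).
  by rewrite expR_gt1 mulr_gt0.
exists n0 => n hn n_gt0; have n0' : 0 < n%:R :> R by rewrite ltr0n.
rewrite ler_pdivrMr // mulrC -(@ler_pM2l _ 5) //.
have := hn0 n hn; rewrite -expRM_natl -[X in X ^+ 5]lnK ?posrE // -expRM_natl ler_expR.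
by rewrite mulrCA.
Qed.

End Growth.

(** * Collisions of differences modulo a large prime *)

Section CountingModPrime.
Variables (p n : nat) (u v : 'rV[int]_n).
Hypothesis p_pr : prime p.
Local Notation d := (cube_diff u v).
Local Notation D := (twice_diff p u v).
Hypothesis p_large : (8 * (\sum_j `|d j|) < p)%N.

Lemma Fp_int_eq0 (z : int) : (`|z| < p)%N -> (z%:~R == 0 :> 'F_p) = (z == 0).
Proof.
move=> zp; apply/eqP/eqP => [|->] //; case: z zp => k /= kp.
  move/eqP; rewrite -[_%:~R]/(k%:R) -(dvdn_pcharf (pchar_Fp p_pr)) => hd.
  by move: kp; case: k hd => // k hd; rewrite ltnNge dvdn_leq.
rewrite NegzE mulrNz => /eqP; rewrite oppr_eq0 -[_%:~R]/(k.+1%:R).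
rewrite -(dvdn_pcharf (pchar_Fp p_pr)) => hd.
by move: kp; rewrite ltnNge dvdn_leq.
Qed.

Lemma abs_diff_le j : (`|d j| <= \sum_j `|d j|)%N.
Proof. by rewrite (bigD1 j) //= leq_addr. Qed.

Lemma twice_diff_neq0 j : u 0 j <> v 0 j -> D j != 0.
Proof.
move=> huv; have hd : d j != 0 by rewrite subr_eq0; apply/eqP.
rewrite /twice_diff Fp_int_eq0 ?mulf_eq0 //.
by rewrite abszM; apply: leq_ltn_trans p_large; rewrite leq_mul // abs_diff_le.
Qed.

Lemma twice_diff_eq i j : D i = D j -> d i = d j.
Proof.
move/eqP; rewrite -subr_eq0 /twice_diff -intrB -mulrBr Fp_int_eq0 => [/eqP h|].
  by apply/eqP; rewrite -subr_eq0; move/eqP: h; rewrite mulf_eq0.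
rewrite abszM; apply: leq_ltn_trans p_large; have hi := abs_diff_le i; have hj := abs_diff_le j.
apply: (@leq_trans (2 * (`|d i| + `|d j|))%N).
  by rewrite leq_mul2l /=; have := leqD_dist (d i) 0 (d j); rewrite subr0 sub0r abszN.
by rewrite -[8%N]/(2 * 4)%N -mulnA leq_mul2l /= mulSn leq_add // mulSn (leq_trans hj) // leq_addr.
Qed.

(** Twice a combination of four differences is at most [8 S] in absolute value, which is below
    [p]. *)
Lemma twice_diff_add_eq i j k l : D i + D j = D k + D l -> d i + d j = d k + d l.
Proof.
move/eqP; rewrite -subr_eq0 /twice_diff -!intrD -intrB -!mulrDr -mulrBr Fp_int_eq0.
  by rewrite mulf_eq0 /= subr_eq0 => /eqP.
set S := (\sum_j `|d j|)%N; have pl : (8 * S < p)%N := p_large.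
have h (z : 'I_n) : (`|d z| <= S)%N := abs_diff_le z.
apply: leq_ltn_trans pl; move: (h i) (h j) (h k) (h l); lia.
Qed.

Lemma card_collision2 : injective d ->
  (#|[set q : 'I_n * 'I_n | D q.1 == D q.2]| <= n)%N.
Proof.
move=> inj; rewrite -[leqRHS]card_ord.
rewrite -(card_in_imset (f := fst)); first exact: max_card.
move=> [i j] [i' j']; rewrite !inE /= => /eqP/twice_diff_eq/inj <- /eqP/twice_diff_eq/inj <-.
by move=> ->.
Qed.

Lemma weak_sidon_injective : weak_sidon n [fset d j | j in 'I_n]%fset -> injective d.
Proof.
case=> cS _; apply/injectiveP; rewrite /injectiveb /dinjectiveb.
apply: (@leq_size_uniq _ [fset d j | j in 'I_n]%fset); first exact: fset_uniq.
  by move=> z /imfsetP[j _ ->]; apply: map_f; rewrite mem_enum.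
by rewrite size_map -cardE card_ord cS.
Qed.

(** Collisions lift to the integers and, as the differences are distinct, embed into the Sidon
    solutions with all four signs [+1]. *)
Lemma card_collision4 : weak_sidon n [fset d j | j in 'I_n]%fset ->
  (#|[set q : ('I_n * 'I_n) * ('I_n * 'I_n) |
      (D q.1.1 + D q.1.2 == D q.2.1 + D q.2.2)%R]| <= 100 * n ^ 2)%N.
Proof.
move=> hS; have inj := weak_sidon_injective hS; case: hS => _; apply: leq_trans.
set S := [fset d j | j in 'I_n]%fset; set T := [set _ | _].
pose f (q : ('I_n * 'I_n) * ('I_n * 'I_n)) : ((int * int) * (int * int)) * ((int * int) * (int * int)) :=
  (((1, d q.1.1), (1, d q.1.2)), ((1, d q.2.1), (1, d q.2.2))).
have finj : injective f.
  by move=> [[i j] [k l]] [[i' j'] [k' l']] [] /inj -> /inj -> /inj -> /inj ->.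
have -> : #|T| = #|` [fset f q | q in T]%fset| by rewrite card_imfset //= -cardE.
apply: fsubset_leq_card; apply/fsubsetP => z /imfsetP[[[i j] [k l]]] /=.
rewrite inE /= => /eqP/twice_diff_add_eq e ->.
have dS m : d m \in S by apply/imfsetP; exists m.
by rewrite !inE /f /= !mul1r e eqxx ?andbT !dS.
Qed.

End CountingModPrime.

(** * Choice of the parameters *)

Section Directions.
Variable R : realType.

Lemma light_density (p n : nat) (omega : complex R) (u v : 'rV[int]_n)
    (a s E0 : nat) (sig : R) :
    prime p -> omega ^+ p = 1 -> omega != 1 -> (0 < n)%N ->
    (8 * (\sum_j `|cube_diff u v j|) < p)%N ->
    ((16 * 4 ^ a.+1) ^ 2 <= p)%N -> (forall j, u 0 j <> v 0 j) ->
    0 < sig -> 64 * 4 ^+ a.+1 * sig <= 1 -> (s <= 4)%N ->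
    \sum_th cmod (charsum (fun j => dilate omega (twice_diff p u v j)) th) ^+ s
      <= (p * E0)%:R ->
  #|light (fun j => dilate omega (twice_diff p u v j)) a sig|%:R / p%:R <=
    p%:R^-1 + 2 ^+ (52 + 16 * a.+1) * sig * (E0%:R / n%:R ^+ s).
Proof.
move=> p_pr wX w1 n_gt0 p_large pa huv sig0 sa s4 hE.
have p0 : 0 < p%:R :> R by rewrite ltr0n prime_gt0.
have cD j th th' : dilate omega (twice_diff p u v j) (th + th') =
    dilate omega (twice_diff p u v j) th * dilate omega (twice_diff p u v j) th'.
  exact: dilateD.
have cU j th : cmod (dilate omega (twice_diff p u v j) th) = 1 by exact: cmod_fpchar.
have far j (th : 'F_p) : th != 0 ->
    1 <= p%:R * chdist (fun j => dilate omega (twice_diff p u v j)) j th.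
  move=> th0; apply: fpchar_far => //; rewrite mulf_neq0 //.
  exact: (twice_diff_neq0 p_pr p_large (huv j)).
have hE' (l l' : nat) : (l < p)%N -> (l' < p)%N -> l != l' ->
    \sum_th cmod (charsum (fun j => dilate omega (twice_diff p u v j))
      (th *+ l - th *+ l')) ^+ s <= (p * E0)%:R.
  move=> hl hl' hll; apply: le_trans hE.
  by rewrite (sum_dilate p_pr (fun th => cmod (charsum _ th) ^+ s) hl hl' hll).
have E00 : 0 <= (p * E0)%:R :> R by rewrite ler0n.
rewrite ler_pdivrMr //.
apply: le_trans (card_light cD cU n_gt0 far sig0 sa pa s4 E00 hE') _.
rewrite mulrDl mulVf ?gt_eqF // natrM le_eqVlt; apply/orP; left; apply/eqP; field.
by rewrite expf_neq0 // pnatr_eq0 -lt0n.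
Qed.

Lemma sqrt_ln_scale (x : R) (n r : nat) : (0 < n)%N ->
  Num.sqrt (x / n%:R ^+ (2 * r).+1) = Num.sqrt (x / n%:R) / n%:R ^+ r.
Proof.
move=> n_gt0; have n0 : 0 < n%:R :> R by rewrite ltr0n.
have -> : x / n%:R ^+ (2 * r).+1 = (n%:R ^- r) ^+ 2 * (x / n%:R).
  rewrite exprS mulnC exprM; field.
  by rewrite expf_neq0 gt_eqF.
rewrite sqrtrM ?sqr_ge0 // sqrtr_sqr ger0_norm ?invr_ge0 ?exprn_ge0 ?ler0n //.
by rewrite mulrC.
Qed.

Definition concentrates (C : R) n (u v : 'rV[int]_n) (x : R) :=
  [/\ x <= C * Num.sqrt (ln n%:R / n%:R),
      injective (cube_diff u v) -> x <= C * Num.sqrt (ln n%:R / n%:R ^+ 3)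
    & weak_sidon n [fset cube_diff u v j | j in 'I_n]%fset ->
      x <= C * Num.sqrt (ln n%:R / n%:R ^+ 5)].

Lemma most_directions (delta : R) : 0 < delta ->
  exists (C : R) (n0 : nat), 0 < C /\
    forall n (u v : 'rV[int]_n) (B : {fset 'rV[int]_n}),
      (n0 <= n)%N -> (2 <= n)%N -> (forall j, u 0 j <> v 0 j) ->
      sign_vectors B -> (0 < #|` B|)%N ->
    exists Bad : {set n.-tuple bool},
      #|Bad|%:R <= 2 ^+ n * (2 `^ delta) ^+ n / #|` B|%:R /\
      forall s : n.-tuple bool, s \notin Bad ->
        forall k, concentrates C u v (prob_dot R B (cube_row u v s) k).
Proof.
(* The number of bad directions carries [h^(7 n)], which becomes [2^(delta n)]. *)
move=> d0; pose h : R := 2 `^ (delta / 7).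
have h7 : h ^+ 7 = 2 `^ delta.
  by rewrite -powR_mulrn ?powR_ge0 // -powRrM mulfVK // pnatr_eq0.
have h1 : 1 < h.
  have h70 : 1 < h ^+ 7.
    by rewrite h7 /powR pnatr_eq0 /= expR_gt1 mulr_gt0 // ln_gt0 // ltr1n.
  rewrite ltNge; apply/negP => hh; move: h70; rewrite ltNge => /negP[].
  by rewrite exprn_ile1 // powR_ge0.
have h0 : 0 < h by apply: lt_trans h1.
have h10 : 0 < h - 1 by rewrite subr_gt0.
pose t := Num.min 1 (h - 1).
have t0 : 0 < t by rewrite lt_min ltr01.
have t1 : t <= 1 by rewrite ge_min lexx.
have ht : 1 + t <= h by rewrite addrC -lerBrDr ge_min lexx orbT.
have [N hN] := exists_expr_ge t^-1 h1.
pose N0 := N.+1.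
have hN0 : t^-1 <= h ^+ N0 by apply: (le_trans hN); rewrite ler_weXn2l // ltW.
have [a ha'] := exists_expr_ge 2 h1.
have ha : 2 <= h ^+ (2 ^ a).
  by apply: (le_trans ha'); rewrite ler_weXn2l ?(ltW h1) // ltnW // ltn_expl.
pose lam := (h - 1) ^+ 2.
have lam0 : 0 < lam by rewrite exprn_gt0.
have N00 : 0 < N0%:R :> R by rewrite ltr0n.
(* With [rho = exp (- lam sig^2 / 8)] and [2 N0 G >= n], the constant [80] gives [rho^G <= n^-5]. *)
pose Kc := 80 * N0%:R / lam.
have Kc0 : 0 < Kc by rewrite divr_gt0 ?mulr_gt0.
pose c : R := (64 * 4 ^+ a.+1)^-1.
have c0 : 0 < c by rewrite invr_gt0 mulr_gt0 ?exprn_gt0.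
have [nA hA] := poly5_le_expr h1.
have [|nB hB] := @ln_div_small R (c ^+ 2 / Kc); first by rewrite divr_gt0 ?exprn_gt0.
pose L : R := Num.sqrt (ln 2).
have ln20 : 0 < ln 2 :> R by rewrite ln_gt0 // ltr1n.
have L0 : 0 < L by rewrite sqrtr_gt0.
pose A : R := 2 ^+ (52 + 16 * a.+1).
have A0 : 0 < A by rewrite exprn_gt0.
(* The first summand is the light density, [100] being the Sidon constant; the second pays for
   [5 tau], namely [4 tau] from the heavy frequencies and [1 / p <= tau]. *)
exists (100 * A * Num.sqrt Kc + 5 / L), (maxn N0 (maxn nA nB)); split.
  apply: addr_gt0; last by rewrite divr_gt0.
  by apply: mulr_gt0; [apply: mulr_gt0 | rewrite sqrtr_gt0].
move=> n u v B; rewrite !geq_max => /and3P[nN0 nnA nnB] n2 huv sB B0.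
have n_gt0 : (0 < n)%N by apply: leq_trans n2.
have n0 : 0 < n%:R :> R by rewrite ltr0n.
have n1 : 1 <= n%:R :> R by rewrite ler1n.
have lnn : ln 2 <= ln n%:R :> R by rewrite ler_ln ?posrE // ler_nat.
have lnn0 : 0 < ln n%:R :> R by apply: lt_le_trans lnn.
pose sig := Num.sqrt (Kc * (ln n%:R / n%:R)).
have sq0 : 0 < Kc * (ln n%:R / n%:R) by apply: mulr_gt0 => //; apply: divr_gt0.
have sig0 : 0 < sig by rewrite sqrtr_gt0.
have sig2 : sig ^+ 2 = Kc * (ln n%:R / n%:R) by rewrite sqr_sqrtr // ltW.
have sigc : 64 * 4 ^+ a.+1 * sig <= 1.
  have : sig <= c.
    rewrite -(@ler_pXn2r _ 2) ?nnegrE ?(ltW sig0) ?(ltW c0) // sig2 mulrC.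
    by rewrite -ler_pdivlMr // hB.
  have -> : 64 * 4 ^+ a.+1 = c^-1 by rewrite /c invrK.
  by rewrite mulrC ler_pdivrMr // mul1r.
pose rho := sequences.expR (- (lam * sig ^+ 2 / 8)).
have rho0 : 0 < rho by exact: expR_gt0.
have rho1 : rho <= 1.
  by rewrite -expR0 ler_expR oppr_le0 divr_ge0 // mulr_ge0 ?sqr_ge0 // ltW.
have hrho : 1 - (h - 1) ^+ 2 * sig ^+ 2 / 8 <= rho by exact: expR_ge1Dx.
pose G := (n %/ N0)%N.
have tG : t ^- G <= h ^+ n.
  rewrite -exprVn; apply: (@le_trans _ _ ((h ^+ N0) ^+ G)).
    by rewrite lerXn2r ?nnegrE ?invr_ge0 ?(ltW t0) ?exprn_ge0 ?(ltW h0).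
  by rewrite -exprM ler_weXn2l ?(ltW h1) // mulnC leq_trunc_div.
have hG : (n <= 2 * N0 * G)%N.
  have G0 : (0 < G)%N by rewrite divn_gt0.
  rewrite {1}(divn_eq n N0) -/G; have := ltn_pmod n (isT : (0 < N0)%N).
  move: (n %% N0)%N => m hm; rewrite -mulnA [(N0 * G)%N]mulnC mul2n -addnn leq_add2l.
  by apply: leq_trans (ltnW hm) _; rewrite leq_pmull.
pose tau2 : R := (n%:R ^+ 5)^-1; pose tau := Num.sqrt tau2.
have tau20 : 0 < tau2 by rewrite invr_gt0 exprn_gt0.
have tau0 : 0 < tau by rewrite sqrtr_gt0.
have tauE : tau ^+ 2 = tau2 by rewrite sqr_sqrtr // ltW.
have rhoG : rho ^+ G <= tau2.
  rewrite /rho -expRM_natl /tau2 -[X in X ^+ 5](@lnK R) ?posrE // -expRM_natl -expRN.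
  rewrite ler_expR mulrN lerN2 sig2.
  have -> : G%:R * (lam * (Kc * (ln n%:R / n%:R)) / 8) =
      5 * ln n%:R * ((2 * N0 * G)%:R / n%:R).
    by rewrite /Kc !natrM; field; rewrite !gt_eqF.
  by rewrite ler_peMr ?mulr_ge0 ?(ltW lnn0) // ler_pdivlMr // mul1r ler_nat.
have hn : h ^- n <= tau2 by rewrite lef_pV2 ?posrE ?exprn_gt0 // hA.
pose S := (\sum_j `|cube_diff u v j|)%N.
(* The three summands ensure faithful reduction of the differences, [1 / p <= tau], and the size
   condition of the light set estimate. *)
have [p p_big p_pr] := prime_above (8 * S + n ^ 3 + (16 * 4 ^ a.+1) ^ 2).
have pS : (8 * S < p)%N by apply: leq_ltn_trans p_big; rewrite -addnA leq_addr.
have pn : (n ^ 3 <= p)%N.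
  by apply: leq_trans (ltnW p_big); rewrite addnAC leq_addl.
have pa : ((16 * 4 ^ a.+1) ^ 2 <= p)%N by apply: leq_trans (ltnW p_big); rewrite leq_addl.
have [w [wX w1]] := exists_root_of_unity R p_pr.
have p0 : 0 < p%:R :> R by rewrite ltr0n prime_gt0.
have ptau : p%:R^-1 <= tau.
  rewrite -(@ler_pXn2r _ 2) ?nnegrE ?invr_ge0 ?(ltW p0) ?(ltW tau0) // tauE exprVn.
  rewrite lef_pV2 ?posrE ?exprn_gt0 //; apply: (@le_trans _ _ ((n%:R ^+ 3) ^+ 2)).
    by rewrite -exprM ler_weXn2l.
  by rewrite lerXn2r ?nnegrE ?exprn_ge0 ?ler0n // -natrX ler_nat.
exists (bad_directions p w u v B h t sig a G); split.
  have := card_bad_directions p_pr wX u v sB B0 sig h1 t0 t1 ht tG ha.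
  by rewrite exprM h7; apply.
move=> s hs k.
have := prob_dot_le p_pr wX w1 sB B0 h1 t0 t1 (ltW sig0) rho0 rho1 hrho k tau0 hs.
set P := prob_dot _ _ _ _; set V := light _ _ _ => hP.
have hP' : P <= #|V|%:R / p%:R + 4 * tau.
  apply: (le_trans hP); rewrite -addrA lerD2l.
  have : (rho ^+ G + 2 * h ^- n) / tau <= 3 * tau.
    by rewrite ler_pdivrMr // -mulrA -expr2 tauE; lra.
  lra.
(* The three bounds are the cases [r = 0, 1, 2], with moment of order [2 r] at most [100 p n^r]. *)
have key r : (r <= 2)%N ->
    \sum_th cmod (charsum (fun j => dilate w (twice_diff p u v j)) th) ^+ (2 * r)
      <= (p * (100 * n ^ r))%:R ->
    P <= (100 * A * Num.sqrt Kc + 5 / L) * Num.sqrt (ln n%:R / n%:R ^+ (2 * r).+1).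
  move=> r2 hE.
  have r4 : (2 * r <= 4)%N by rewrite (leq_mul2l 2 r 2).
  have := light_density p_pr wX w1 n_gt0 pS pa huv sig0 sigc r4 hE.
  rewrite -/V -/A => hV.
  set T := Num.sqrt (ln n%:R / n%:R ^+ (2 * r).+1).
  have sT : A * sig * ((100 * n ^ r)%:R / n%:R ^+ (2 * r)) = 100 * A * Num.sqrt Kc * T.
    rewrite /T sqrt_ln_scale // /sig sqrtrM ?(ltW Kc0) // natrM natrX mul2n -addnn exprD.
    by field; rewrite expf_neq0 // gt_eqF.
  have tT : tau <= T / L.
    rewrite ler_pdivlMr // /tau /L -sqrtrM ?(ltW tau20) // ler_wsqrtr //.
    rewrite mulrC; apply: ler_pM; rewrite ?(ltW ln20) ?(ltW tau20) //.
    rewrite lef_pV2 ?posrE ?exprn_gt0 // ler_weXn2l // ltnS (leq_mul2l 2 r 2).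
  rewrite sT in hV.
  have -> : (100 * A * Num.sqrt Kc + 5 / L) * T = 100 * A * Num.sqrt Kc * T + 5 * (T / L).
    by ring.
  lra.
split.
- have := key 0%N isT; rewrite muln0 expr1; apply.
  by rewrite (eq_bigr (fun _ => 1)) // sumr_const card_Fp // ler_nat leq_pmulr.
- move=> inj; have := key 1%N isT; rewrite muln1; apply.
  apply: (moment2 p_pr wX w1); apply: leq_trans (card_collision2 p_pr pS inj) _.
  by rewrite expn1 leq_pmull.
move=> hS; have := key 2 isT; apply.
by apply: (moment4 p_pr wX w1); exact: (card_collision4 p_pr pS hS).
Qed.

End Directions.

(** * Transfer to the two-cube and small dimensions *)

Local Open Scope classical_set_scope.
Local Open Scope ring_scope.

Lemma all_but_cube (R : realType) (n : nat) (A : set 'rV[int]_n)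
    (u v : 'rV[int]_n) (N : R) (P : 'rV[int]_n -> Prop)
    (Bad : {set n.-tuple bool}) :
  two_cube A u v -> #|Bad|%:R <= N ->
  (forall s : n.-tuple bool, s \notin Bad -> P (cube_row u v s)) ->
  all_but N A P.
Proof.
move=> [huv AE] hN hP; pose F := [fset cube_row u v (val s) | s in Bad]%fset.
have sub : A `&` [set x | ~ P x] `<=` [set` F].
  move=> x [Ax nPx]; rewrite AE in Ax.
  have xE : x = cube_row u v [tuple x 0 i == u 0 i | i < n].
    apply/rowP => j; rewrite mxE -tnth_nth tnth_mktuple.
    by case: (Ax j) => ->; rewrite ?eqxx //; case: eqP.
  rewrite /= xE; apply: in_imfset => /=; apply/negPn/negP => hb.
  by apply: nPx; rewrite xE; apply: hP.
have fin : finite_set (A `&` [set x | ~ P x]).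
  by apply: sub_finite_set sub _; exact: finite_fset.
split=> //; apply: le_trans hN; rewrite ler_nat.
apply: (@leq_trans #|` F|).
  apply: fsubset_leq_card; apply/fsubsetP => x; rewrite in_fset_set // inE.
  by move/sub.
by apply: leq_trans (leq_imfset_card _ _ _) _; rewrite -cardE.
Qed.

Lemma concentrates_le (R : realType) (C C' x : R) n (u v : 'rV[int]_n) :
  C <= C' -> concentrates C u v x -> concentrates C' u v x.
Proof.
move=> hC [h1 h3 h5]; split=> [|/h3 h|/h5 h]; first move: h1 => h.
all: by apply: (le_trans h); rewrite ler_wpM2r ?sqrtr_ge0.
Qed.

Lemma max_prob_le1 (R : realType) n (B : {fset 'rV[int]_n}) x : max_prob R B x <= 1.
Proof.
have [[k ->] _] := max_prob_attained R B x; rewrite /prob_dot.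
have [->|B0] := eqVneq #|` B| 0%N; first by rewrite invr0 mulr0.
rewrite ler_pdivrMr ?ltr0n ?lt0n // mul1r ler_nat.
by apply: fsubset_leq_card; apply/fsubsetP => y; rewrite !inE => /andP[].
Qed.

(** Makes the concentration bounds trivial in dimensions up to [m]: [ln 2 <= ln n] and
    [n^e <= m^6]. *)
Lemma sqrt_ln_ge (R : realType) (n m e : nat) : (2 <= n)%N -> (n <= m)%N -> (e <= 5)%N ->
  1 <= m%:R ^+ 3 / Num.sqrt (ln 2) * Num.sqrt (ln n%:R / n%:R ^+ e) :> R.
Proof.
move=> n2 nm e5; have n0 : 0 < n%:R :> R by rewrite ltr0n (leq_trans _ n2).
have n1 : 1 <= n%:R :> R by rewrite ler1n (leq_trans _ n2).
have m1 : 1 <= m%:R :> R by apply: le_trans n1 _; rewrite ler_nat.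
have m0 : 0 < m%:R :> R by apply: lt_le_trans m1.
have ln20 : 0 < ln 2 :> R by rewrite ln_gt0 // ltr1n.
have L0 : 0 < Num.sqrt (ln 2) :> R by rewrite sqrtr_gt0.
rewrite mulrAC ler_pdivlMr // mul1r mulrC -ler_pdivrMr ?exprn_gt0 //.
have -> : Num.sqrt (ln 2) / m%:R ^+ 3 = Num.sqrt (ln 2 / (m%:R ^+ 3) ^+ 2) :> R.
  by rewrite sqrtrM ?(ltW ln20) // -[((_ ^+ 3) ^+ 2)^-1]exprVn sqrtr_sqr ger0_norm // invr_ge0 exprn_ge0 ?ler0n.
apply: ler_wsqrtr; apply: ler_pM; rewrite ?invr_ge0 ?exprn_ge0 ?ler0n ?(ltW ln20) //.
  by rewrite ler_ln ?posrE // ler_nat.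
rewrite lef_pV2 ?posrE ?exprn_gt0 // -exprM.
apply: (@le_trans _ _ (m%:R ^+ e)); first by rewrite lerXn2r ?nnegrE ?ler0n // ler_nat.
by rewrite ler_weXn2l // (leq_trans e5).
Qed.

Theorem theorem4 (R : realType) (beta delta : R)
    (hbeta : 0 < beta) (hdelta : 0 < delta) :
  exists C : R, 0 < C /\
    forall (n : nat) (A : set 'rV[int]_n) (u v : 'rV[int]_n)
           (B : {fset 'rV[int]_n}),
      (2 <= n)%N ->
      two_cube A u v ->
      sign_vectors B ->
      #|` B|%:R = 2 `^ (beta * n%:R) ->
      [/\ all_but (2 `^ (n%:R * (1 - beta + delta))) A
            (fun x => max_prob R B x <= C * Num.sqrt (ln n%:R / n%:R)),
          injective (cube_diff u v) ->
          all_but (2 `^ (n%:R * (1 - beta + delta))) A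
            (fun x => max_prob R B x <= C * Num.sqrt (ln n%:R / n%:R ^+ 3))
        & weak_sidon n [fset cube_diff u v j | j in 'I_n]%fset ->
          all_but (2 `^ (n%:R * (1 - beta + delta))) A
            (fun x => max_prob R B x <= C * Num.sqrt (ln n%:R / n%:R ^+ 5))].
Proof.
have [C1 [n0 [C10 hC]]] := most_directions hdelta.
pose Cs : R := n0%:R ^+ 3 / Num.sqrt (ln 2).
have Cs0 : 0 <= Cs by rewrite divr_ge0 ?exprn_ge0 ?ler0n ?sqrtr_ge0.
exists (C1 + Cs); split; first by rewrite ltr_wpDr.
move=> n A u v B n2 tA sB cB; have [huv _] := tA.
have B0 : (0 < #|` B|)%N by rewrite -(ltr_nat R) cB powR_gt0.
(* One exceptional set serves all three parts. *)
suff [Bad [hBad hconc]] : exists Bad : {set n.-tuple bool},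
    #|Bad|%:R <= 2 `^ (n%:R * (1 - beta + delta)) /\
    forall s : n.-tuple bool, s \notin Bad ->
      concentrates (C1 + Cs) u v (max_prob R B (cube_row u v s)).
  split=> [|inj|hS]; apply: (all_but_cube tA hBad) => s /hconc[h1 h3 h5] //.
  - exact: h3.
  - exact: h5.
case: (leqP n0 n) => [le_n0|/ltnW le_n].
  have [Bad [hBad hconc]] := hC n u v B le_n0 n2 huv sB B0.
  exists Bad; split.
    apply: (le_trans hBad); rewrite cB -powRN -!powR_mulrn ?powR_ge0 // -powRrM.
    rewrite -!powRD ?pnatr_eq0 ?implybT //.
    by rewrite le_eqVlt; apply/orP; left; apply/eqP; congr (_ `^ _); ring.
  move=> s hs; have [[k ->] _] := max_prob_attained R B (cube_row u v s).
  by apply: concentrates_le (hconc s hs k); rewrite lerDl.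
(* Below [n0] no direction is exceptional, since the summand [Cs] makes every bound at least [1]. *)
exists finset.set0; split; first by rewrite cards0 powR_ge0.
move=> s _; have hp := max_prob_le1 R B (cube_row u v s).
have big e : (e <= 5)%N ->
    max_prob R B (cube_row u v s) <= (C1 + Cs) * Num.sqrt (ln n%:R / n%:R ^+ e).
  move=> e5; apply: (le_trans hp); apply: (le_trans (sqrt_ln_ge R n2 le_n e5)).
  by rewrite ler_wpM2r ?sqrtr_ge0 // lerDr ltW.
split=> [|_|_]; [|exact: big|exact: big].
by have := big 1%N isT; rewrite expr1.
Qed.
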